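(* Let $n$ be a positive integer, let $E$ be a subset of an $n$-dimensional manifold $M$, and let $f: E \to \mathbb{R}^n$ be a continuous map that is zero-free on the interior $E^\circ$ of $E$ in $M$. Then $f$ can be approximated in the fine topology by a continuous $\mathbb{R}^n$-valued map that is zero-free on all of $E$; that is, for every positive continuous function $\varepsilon: E\to \mathbb{R}_+$ there is a continuous map $g:E\to\mathbb{R}^n$ such that $g(x)\neq 0$ for every $x\in E$ and $|f(x)-g(x)|<\varepsilon(x)$ for every $x\in E$.
   Context: An $n$-dimensional manifold is a paracompact Hausdorff space every point of which has a neighborhood that is homeomorphic to an open subset of $\mathbb{R}^n$ (no second countability or connectedness is assumed). $|\cdot|$ denotes the Euclidean norm on $\mathbb{R}^n$, and $\mathbb{R}_+=\{t\in\mathbb{R}: t>0\}$. A map $f$ into $\mathbb{R}^n$ is zero-free on a set $L$ if $f(x)\neq 0$ for every $x\in L$. $E$ carries the subspace topology. The fine topology on the set $C(E,\mathbb{R}^n)$ of continuous maps from $E$ to $\mathbb{R}^n$ is the topology having as a basis all sets of the form $B(f,\varepsilon)=\{g\in C(E,\mathbb{R}^n): |f(x)-g(x)|<\varepsilon(x)\text{ for all }x\in E\}$, for $f\in C(E,\mathbb{R}^n)$ and $\varepsilon:E\to\mathbb{R}_+$ continuous. *)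

(* Defs.v *)
From HB Require Import structures.
From mathcomp Require Import all_boot all_order all_algebra.
From mathcomp Require Import all_classical all_reals all_analysis.
From mathcomp Require Import ring.

Set Implicit Arguments.
Unset Strict Implicit.
Unset Printing Implicit Defensive.
Set SsrOldRewriteGoalsOrder.

Import Order.TTheory GRing.Theory Num.Theory.
Import numFieldTopology.Exports numFieldNormedType.Exports.

Local Open Scope classical_set_scope.
Local Open Scope ring_scope.

Definition open_cover (X : topologicalType) (F : set (set X)) : Prop :=
  (forall U, F U -> open U) /\ \bigcup_(U in F) U = setT.

Definition locally_finite (X : topologicalType) (F : set (set X)) : Prop :=
  forall x : X, exists2 N : set X,
    nbhs x N & finite_set [set U | F U /\ U `&` N !=set0].

Definition refines (X : Type) (G F : set (set X)) : Prop :=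
  forall V, G V -> exists2 U, F U & V `<=` U.

Definition paracompact (X : topologicalType) : Prop :=
  forall F : set (set X), open_cover F ->
  exists G : set (set X), [/\ open_cover G, refines G F & locally_finite G].

Definition homeomorphic (X Y : topologicalType) : Prop :=
  exists (h : X -> Y) (k : Y -> X),
    [/\ continuous h, continuous k, cancel h k & cancel k h].

(* A set used as a type is [set_type], which carries the subspace topology. *)
Definition locally_euclidean (R : realType) (n : nat) (X : topologicalType) :
    Prop :=
  forall x : X, exists (U : set X) (V : set 'rV[R]_n),
    [/\ nbhs x U, open V & homeomorphic U V].

Definition manifold (R : realType) (n : nat) (X : topologicalType) : Prop :=
  [/\ paracompact X, hausdorff_space X & locally_euclidean R n X].

Definition zero_free (R : realType) (n : nat) (X : Type) (L : set X)
    (f : X -> 'rV[R]_n) : Prop :=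
  forall x, L x -> f x <> 0.

(* The library norm on ['rV[R]_n] is the sup norm; the two norms induce the
   same topology. *)
Definition enorm (R : realType) (n : nat) (v : 'rV[R]_n) : R :=
  Num.sqrt (\sum_(i < n) v 0 i ^+ 2).

Section enorm_theory.
Context (R : realType) (n : nat).
Implicit Types u v w : 'rV[R]_n.

Let dot u v := \sum_(i < n) u 0 i * v 0 i.

Let enormE u : enorm u ^+ 2 = dot u u.
Proof.
rewrite sqr_sqrtr; last by apply: sumr_ge0 => i _; exact: sqr_ge0.
by apply: eq_bigr => i _; rewrite expr2.
Qed.

Lemma enorm_ge0 u : 0 <= enorm u. Proof. exact: sqrtr_ge0. Qed.

Lemma enorm0 : enorm (0 : 'rV[R]_n) = 0.
Proof. by rewrite /enorm big1 ?sqrtr0// => i _; rewrite mxE expr0n. Qed.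

Let enorm_eq0 u : enorm u = 0 -> forall i, u 0 i = 0.
Proof.
move=> u0 i; have := enormE u; rewrite u0 expr0n/= => /esym/eqP.
rewrite psumr_eq0 => [/allP/(_ i)|j _]; last by rewrite -expr2 sqr_ge0.
by rewrite mem_index_enum mulf_eq0 orbb => /(_ isT)/eqP.
Qed.

Let cauchy_schwarz u v : dot u v <= enorm u * enorm v.
Proof.
have := enorm_ge0 u; rewrite le_eqVlt => /predU1P[u0|u0].
  rewrite -u0 mul0r /dot big1// => i _.
  by rewrite (enorm_eq0 (esym u0)) mul0r.
have := enorm_ge0 v; rewrite le_eqVlt => /predU1P[v0|v0].
  rewrite -v0 mulr0 /dot big1// => i _.
  by rewrite (enorm_eq0 (esym v0)) mulr0.
have : 0 <= \sum_(i < n) (enorm v * u 0 i - enorm u * v 0 i) ^+ 2.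
  by apply: sumr_ge0 => i _; exact: sqr_ge0.
have -> : \sum_(i < n) (enorm v * u 0 i - enorm u * v 0 i) ^+ 2 =
    enorm v ^+ 2 * dot u u - (enorm u * enorm v * dot u v) *+ 2
    + enorm u ^+ 2 * dot v v.
  rewrite /dot !mulr_sumr -sumrMnl -sumrB -big_split/=.
  by apply: eq_bigr => i _; ring.
rewrite -!enormE.
have -> : enorm v ^+ 2 * enorm u ^+ 2 - (enorm u * enorm v * dot u v) *+ 2 +
    enorm u ^+ 2 * enorm v ^+ 2 =
    (enorm u * enorm v) * (enorm u * enorm v - dot u v) *+ 2 by ring.
by rewrite pmulrn_lge0// pmulr_rge0 ?mulr_gt0// subr_ge0.
Qed.

Lemma enormD u v : enorm (u + v) <= enorm u + enorm v.
Proof.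
rewrite -(@ler_pXn2r _ 2)// ?nnegrE ?addr_ge0 ?enorm_ge0//.
have -> : enorm (u + v) ^+ 2 = enorm u ^+ 2 + dot u v *+ 2 + enorm v ^+ 2.
  rewrite !enormE /dot -sumrMnl -!big_split/=.
  by apply: eq_bigr => i _; rewrite !mxE; ring.
by rewrite sqrrD lerD2r lerD2l lerMn2r/= cauchy_schwarz.
Qed.

Lemma enorm_continuous : continuous (@enorm R n).
Proof.
move=> u; apply: (@continuous_comp _ _ _
  (fun v : 'rV[R]_n => \sum_(i < n) v 0 i ^+ 2) (@Num.sqrt R)); last first.
  exact: sqrt_continuous.
apply: (@continuous_big _ _ +%R 0 xpredT _ _ _
  (fun (i : 'I_n) (v : 'rV[R]_n) => v 0 i ^+ 2)).
  exact: add_continuous.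
move=> i _ v; apply: (@continuous_comp _ _ _
  (fun w : 'rV[R]_n => w 0 i) (fun x : R => x ^+ 2)).
  exact: coord_continuous.
exact: exprn_continuous.
Qed.

End enorm_theory.

(* [continuousType X 'rV[R]_n] already carries a topology in the library; this
   alias carries the fine topology instead. *)
Definition fine_space (X : topologicalType) (R : realType) (n : nat) : Type :=
  continuousType X 'rV[R]_n.

HB.instance Definition _ (X : topologicalType) (R : realType) (n : nat) :=
  Choice.copy (fine_space X R n) (continuousType X 'rV[R]_n).

Definition fine_ball (X : topologicalType) (R : realType) (n : nat)
    (f : fine_space X R n) (eps : X -> R) : set (fine_space X R n) :=
  [set g | forall x, enorm (f x - g x) < eps x].

Definition fine_base (X : topologicalType) (R : realType) (n : nat) :
    set (set (fine_space X R n)) :=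
  [set B | exists (f : fine_space X R n) (eps : X -> R),
    [/\ continuous eps, forall x, 0 < eps x & B = fine_ball f eps]].

Section fine_topology.
Context (X : topologicalType) (R : realType) (n : nat).

Let fine_base_cover : \bigcup_(B in @fine_base X R n) B = setT.
Proof.
rewrite -subTset => f _; exists (fine_ball f (cst 1)).
  by exists f, (cst 1); split => //; exact: cst_continuous.
by move=> x; rewrite subrr enorm0 ltr01.
Qed.

Let fine_base_join (A B : set (fine_space X R n)) h :
  fine_base A -> fine_base B -> A h -> B h ->
  exists C, [/\ fine_base C, C h & C `<=` A `&` B].
Proof.
move=> [f [d [cd d0 ->]]] [g [e [ce e0 ->]]] fh gh.
have cdist (k : fine_space X R n) : continuous (fun x => enorm (k x - h x)).
  move=> x; apply: (@continuous_comp _ _ _ (fun x => k x - h x) (@enorm R n)).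
    by apply: cvgB; exact: cts_fun.
  exact: enorm_continuous.
pose r x := Num.min (d x - enorm (f x - h x)) (e x - enorm (g x - h x)).
exists (fine_ball h r); split.
- exists h, r; split => // x.
    apply: (@continuous_min _ _ (fun x => d x - enorm (f x - h x))
      (fun x => e x - enorm (g x - h x))).
      by apply: cvgB; [exact: cd|exact: cdist].
    by apply: cvgB; [exact: ce|exact: cdist].
  by rewrite /r lt_min !subr_gt0 fh gh.
- by move=> x; rewrite subrr enorm0 /r lt_min !subr_gt0 fh gh.
- have tri (k l : fine_space X R n) x :
      enorm (k x - l x) <= enorm (k x - h x) + enorm (h x - l x).
    by rewrite (le_trans _ (enormD _ _))// addrA subrK.
  move=> k hk; split=> x; have := hk x; rewrite /r lt_min !ltrBrDl => /andP[].
    by move=> + _; exact: le_lt_trans (tri _ _ _).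
  by move=> _; exact: le_lt_trans (tri _ _ _).
Qed.

HB.instance Definition _ := isBaseTopological.Build (fine_space X R n)
  fine_base_cover fine_base_join.

End fine_topology.

(* Main.v *)
Require Import Defs.
From HB Require Import structures.
From mathcomp Require Import all_boot all_order all_algebra.
From mathcomp Require Import all_classical all_reals all_analysis.
From mathcomp Require Import ring lra.
Import Order.TTheory GRing.Theory Num.Theory.
Import numFieldTopology.Exports numFieldNormedType.Exports.
Local Open Scope classical_set_scope.
Local Open Scope ring_scope.

Set Implicit Arguments.
Unset Strict Implicit.
Unset Printing Implicit Defensive.

(** The proof has a Euclidean core and a patching argument.

Core, for E in R^n and tolerance 1.  Let Y be the complement of E.  The zeros
of f lie in E but outside its interior, so they are limits of points of Y, and
the idea is to push every zero through a nearby point of Y, where E has a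
hole.  First f is replaced by a map F on an open neighbourhood U of E, close
to f on E, such that every zero of F lies in a small cube (a ball of the sup
norm) centred at a point p of Y and contained in the open set N where F is
small ([euclidean_zero_free]).  This needs F = f deep inside the interior of
E, where no point of Y is near; there f has no zero, and later perturbations
are kept below |F|.  By [lipschitz_avoid_spheres] F can also be made zero-free
on the boundaries of countably many prescribed cubes: they are pieces of
hyperplanes, whose images under a locally Lipschitz map are meagre.  Let r be
the radial push from p onto the boundary of its cube.  Then F o r is defined
off p, hence on E, has no zero in the cube and equals F outside it.  Doing
this for one cube after the other ([remove_zeros]) removes all zeros.  Every
value that was changed lies in F(N) and replaces a value in F(N), so the
result stays close to f however many cubes overlap.

Patching.  Let O be an open subset of M that is homeomorphic to an open subset
of R^n and is the set where a continuous lam : M -> [0, 1] is positive.  The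
core applied to f / (lam eps) on E meet O and scaled back gives a zero-free
map on E meet O that is within lam eps of f; as lam vanishes on the boundary
of O, it extends by f to a continuous map on E ([chart_zero_free]).  The
result is zero-free on E meet O and at every point where f was nonzero, so
such changes can be made in succession.  Each point of M has a neighbourhood
all of whose open subsets are such sets O ([locally_euclidean_cozero]);
paracompactness gives a locally finite cover by them, and Zorn's lemma
composes the changes over the whole, possibly uncountable, cover
([manifold_zero_free]). *)

(** * Row vectors and continuity within a subset *)

Lemma rV_norm_leP (R : realType) n (v : 'rV[R]_n) (e : R) : 0 <= e ->
  `|v| <= e <-> (forall i, `|v 0 i| <= e).
Proof.
move=> e0; rewrite [`|v|]/Num.Def.normr /= mx_normrE; split.
  move=> /bigmax_leP[_ H] i; exact: (H (0, i)).
by move=> H; apply/bigmax_leP; split => // -[i j] _ /=; rewrite ord1.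
Qed.

Lemma rV_norm_ltP (R : realType) n (v : 'rV[R]_n) (e : R) : 0 < e ->
  `|v| < e <-> (forall i, `|v 0 i| < e).
Proof.
move=> e0; rewrite [`|v|]/Num.Def.normr /= mx_normrE; split.
  move=> /bigmax_ltP[_ H] i; exact: (H (0, i)).
by move=> H; apply/bigmax_ltP; split => // -[i j] _ /=; rewrite ord1.
Qed.

Lemma rV_coord_le (R : realType) n (v : 'rV[R]_n) i : `|v 0 i| <= `|v|.
Proof. exact: (rV_norm_leP v (normr_ge0 v)).1. Qed.

Lemma rat_rV_dense (R : realType) n (x : 'rV[R]_n) (e : R) : 0 < e ->
  exists q : 'rV[rat]_n, `|x - map_mx ratr q| < e.
Proof.
move=> e0.
have H i : exists q : rat, `|x 0 i - ratr q| < e.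
  have /rat_in_itvoo[q] : x 0 i - e < x 0 i + e by lra.
  rewrite in_itv /= => /andP[q1 q2]; exists q.
  by rewrite ltr_norml; apply/andP; split; lra.
exists (\row_i projT1 (cid (H i))); apply/rV_norm_ltP => // i.
by rewrite !mxE; case: cid.
Qed.

(** Continuity for the subspace topology in terms of the filter of the ambient
    space, stated without the type alias that marks subspaces. *)
Lemma within_contP (T U : topologicalType) (A : set T) (f : T -> U) :
  {within A, continuous f} <->
  forall x, A x -> f @ within A (nbhs x) --> f x.
Proof. exact: subspace_continuousP. Qed.

(** Lipschitz on balls, with constants depending on the ball: the regularity
    that makes images of hyperplane pieces meagre. *)
Definition locally_lipschitz (R : realType) (V W : normedModType R) (U : set V)
    (F : V -> W) := forall x, U x -> exists s k : R,
  0 < s /\ forall y z, `|x - y| < s -> `|x - z| < s ->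
    `|F y - F z| <= k * `|y - z|.

(** The weights 2^-(k+1) sum to 1, so the bound on the terms passes to the
    sum. *)
Lemma dyadic_series (R : realType) (a : R^nat) (c : R) :
  (forall k, `|a k| <= c * 2^-1 ^+ k.+1) ->
  cvgn (series a) /\ `|limn (series a)| <= c.
Proof.
move=> H.
have hlt : `|2^-1 : R| < 1 by rewrite ger0_norm; lra.
have cg := @cvg_geometric_series R (c / 2) 2^-1 hlt.
have limg : limn (series (geometric (c / 2) 2^-1)) = c.
  by rewrite (cvg_lim _ cg) //; field.
have cg' : cvgn (series (geometric (c / 2) 2^-1)).
  by apply/cvg_ex; eexists; exact: cg.
have ge k : geometric (c / 2) 2^-1 k = c * 2^-1 ^+ k.+1 by rewrite /= exprS mulrA.
have cn : cvgn [normed series a].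
  apply: (series_le_cvg _ _ _ cg') => k; first exact: normr_ge0.
    by rewrite ge (le_trans _ (H k)).
  by rewrite ge; exact: H.
split; first exact: normed_cvg.
apply: (le_trans (lim_series_norm cn)); rewrite -limg.
by apply: lim_series_le => // k; rewrite ge; exact: H.
Qed.

(** * Locally Lipschitz approximation near an arbitrary subset *)

(** Weighted sums of countably many bumps, with weights so small that the sum
    is Lipschitz everywhere; a quotient of two such sums is then locally
    Lipschitz, however the bumps overlap. *)
Section bump_series.
Context (R : realType) (n : nat) (b : nat -> 'rV[R]_n -> R) (c s : nat -> R).
Hypothesis b_bound : forall k y, `|b k y| <= s k.
Hypothesis b_lip : forall k y z, `|b k y - b k z| <= `|y - z|.
Hypothesis c_bound : forall k, `|c k| * (1 + s k) <= 2^-1 ^+ k.+1.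

Let s_ge0 k : 0 <= s k.
Proof. exact: le_trans (normr_ge0 _) (b_bound k 0). Qed.

Definition bump_sum (y : 'rV[R]_n) : R := limn (series (fun k => c k * b k y)).

Lemma bump_sumP y :
  cvgn (series (fun k => c k * b k y)) /\ `|bump_sum y| <= 1.
Proof.
apply: dyadic_series => k; rewrite mul1r; apply: le_trans (c_bound k).
rewrite normrM ler_wpM2l //; apply: (le_trans (b_bound k y)); lra.
Qed.

Lemma bump_sum_lipschitz y z : `|bump_sum y - bump_sum z| <= `|y - z|.
Proof.
rewrite /bump_sum -lim_seriesB; try exact: (bump_sumP _).1.
apply: (dyadic_series _).2 => k.
have -> : ((fun k => c k * b k y) - (fun k => c k * b k z)) k =
  c k * (b k y - b k z) by rewrite /= mulrBr.
rewrite normrM mulrC; apply: ler_pM => //.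
apply: le_trans (c_bound k); rewrite ler_peMr //.
have := s_ge0 k; lra.
Qed.

End bump_series.

Lemma quotient_lipschitz (R : realType) (a b a' b' m d : R) :
  0 < m -> m <= b -> m <= b' -> `|a| <= 1 -> `|b| <= 1 ->
  `|a - a'| <= d -> `|b - b'| <= d -> `|a / b - a' / b'| <= 2 / m ^+ 2 * d.
Proof.
move=> m0 mb mb' a1 b1 aa bb.
have b0 : 0 < b by lra.
have b'0 : 0 < b' by lra.
have -> : a / b - a' / b' = (b * (a - a') - a * (b - b')) / (b * b').
  by field; rewrite !gt_eqF.
have H : `|b * (a - a') - a * (b - b')| <= 2 * d.
  apply: (le_trans (ler_normB _ _)); rewrite !normrM.
  have -> : 2 * d = 1 * d + 1 * d by ring.
  by apply: lerD; apply: ler_pM.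
have -> : 2 / m ^+ 2 * d = (2 * d) * (m ^+ 2)^-1 by rewrite mulrAC.
rewrite normrM normfV; apply: ler_pM => //.
rewrite ger0_norm; last by rewrite mulr_ge0 // ltW.
rewrite lef_pV2 ?posrE ?exprn_gt0 ?mulr_gt0 //.
by rewrite expr2; apply: ler_pM => //; apply: ltW.
Qed.

(** F is the average of sampled values of f, with one sample for each rational
    cube on which f oscillates by less than eta / 2, weighted by a bump
    supported in that cube.  At a point x of E only cubes containing x
    contribute, so F x is an average of values that are close to f x.  The
    average makes sense where the total weight is positive, which is an open
    neighbourhood of E. *)
Lemma lipschitz_approx (R : realType) m n (E : set 'rV[R]_m)
    (f : 'rV[R]_m -> 'rV[R]_n) (eta : R) :
  0 < eta -> {within E, continuous f} ->
  exists (U : set 'rV[R]_m) (F : 'rV[R]_m -> 'rV[R]_n),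
  [/\ open U, E `<=` U, locally_lipschitz U F &
      forall x, E x -> `|F x - f x| < eta].
Proof.
move=> eta0 /within_contP cf.
pose code k : 'rV[rat]_m * rat := odflt (0, 0) (unpickle k).
pose a k : 'rV[R]_m := map_mx ratr (code k).1.
pose r k : R := `|ratr (code k).2|.
pose small k := forall x y, E x -> E y -> `|x - a k| < r k ->
  `|y - a k| < r k -> `|f x - f y| < eta / 2.
pose touch k := [set x | E x /\ `|x - a k| < r k].
pose v k := f (xget 0 (touch k)).
pose b k (y : 'rV[R]_m) : R :=
  if `[<small k>] then Num.max 0 (r k - `|y - a k|) else 0.
have r0 k : 0 <= r k by exact: normr_ge0.
have b0 k y : 0 <= b k y by rewrite /b; case: ifP => // _; rewrite le_max lexx.
have b_bound k y : `|b k y| <= r k.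
  rewrite ger0_norm // /b; case: ifP => // _; rewrite ge_max r0 /=.
  by have := normr_ge0 (y - a k); lra.
have b_lip k y z : `|b k y - b k z| <= `|y - z|.
  rewrite /b; case: ifP => _; last by rewrite subrr normr0.
  have H1 : `|y - a k| <= `|y - z| + `|z - a k|.
    by rewrite -[y - a k](subrKA z) ler_normD.
  have H2 : `|z - a k| <= `|y - z| + `|y - a k|.
    by rewrite -[z - a k](subrKA y) [`|y - z|]distrC ler_normD.
  have H3 := normr_ge0 (y - z).
  rewrite ler_norml; case: (lerP 0 (r k - `|y - a k|)) => h1;
    case: (lerP 0 (r k - `|z - a k|)) => h2; lra.
(* The denominator absorbs both the height r k of the bump and the size of the
   sampled value, so that weights and weighted values are dyadically small. *)
pose c k := 2^-1 ^+ k.+1 / ((1 + r k) * (1 + `|v k|)).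
have D0 k : 0 < (1 + r k) * (1 + `|v k|) by rewrite mulr_gt0 // ltr_pwDl.
have h0 k : 0 < 2^-1 ^+ k.+1 :> R by rewrite exprn_gt0 // invr_gt0.
have c0 k : 0 < c k by rewrite divr_gt0.
have cE k : c k * (1 + r k) * (1 + `|v k|) = 2^-1 ^+ k.+1.
  by rewrite -mulrA /c divfK // gt_eqF.
have c_bound k : `|c k| * (1 + r k) <= 2^-1 ^+ k.+1.
  rewrite (ger0_norm (ltW (c0 k))) -cE ler_peMr ?lerDl //.
  by apply: mulr_ge0; [exact: ltW|exact: addr_ge0].
have cv_bound i k : `|c k * v k 0 i| * (1 + r k) <= 2^-1 ^+ k.+1.
  rewrite normrM (ger0_norm (ltW (c0 k))) mulrAC -cE ler_wpM2l //.
    by apply: mulr_ge0; [exact: ltW|exact: addr_ge0].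
  by apply: (le_trans (rV_coord_le _ _)); rewrite lerDr.
pose den := bump_sum b c.
pose num i := bump_sum b (fun k => c k * v k 0 i).
have denP y := bump_sumP b_bound c_bound y.
have numP i y := bump_sumP b_bound (cv_bound i) y.
have den_lip y z : `|den y - den z| <= `|y - z|.
  exact: bump_sum_lipschitz b_bound b_lip c_bound y z.
have num_lip i y z : `|num i y - num i z| <= `|y - z|.
  exact: bump_sum_lipschitz b_bound b_lip (cv_bound i) y z.
have Epos x : E x -> 0 < den x.
  move=> Ex.
  have /cvgr_dist_lt /(_ (eta / 4)) := cf x Ex.
  have e4 : 0 < eta / 4 by lra.
  move=> /(_ e4) /nbhs_ballP[d /= d0 Hd].
  have Hd' y : E y -> `|x - y| < d -> `|f x - f y| < eta / 4.
    by move=> Ey xy; apply: Hd => //; rewrite -ball_normE.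
  have /rat_in_itvoo[q] : d / 4 < d / 2 by lra.
  rewrite in_itv /= => /andP[q1 q2].
  have q0 : 0 < ratr q :> R by lra.
  have [p Hp] := @rat_rV_dense R m x _ q0.
  pose k := pickle (p, q).
  have codek : code k = (p, q) by rewrite /code pickleK.
  have ak : a k = map_mx ratr p by rewrite /a codek.
  have rk : r k = ratr q by rewrite /r codek /= ger0_norm // ltW.
  have near y : `|y - a k| < r k -> `|x - y| < d.
    rewrite ak rk => yk; rewrite -(subrKA (map_mx ratr p)).
    apply: (le_lt_trans (ler_normD _ _)); rewrite [in X in _ + X]distrC; lra.
  have Sk : small k.
    move=> y z Ey Ez yk zk; have := Hd' _ Ey (near _ yk).
    have := Hd' _ Ez (near _ zk); rewrite -[f y - f z](subrKA (f x)) => h1 h2.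
    apply: (le_lt_trans (ler_normD _ _)); rewrite [in X in X + _]distrC; lra.
  have bk : 0 < c k * b k x.
    rewrite mulr_gt0 // /b asboolT // lt_max; apply/orP; right.
    by rewrite subr_gt0 rk ak.
  have nd : nondecreasing_seq (series (fun k => c k * b k x)).
    apply/nondecreasing_series => j _ _.
    by rewrite mulr_ge0 // ltW.
  have := nondecreasing_cvgn_le nd (denP x).1 k.+1.
  apply: lt_le_trans; rewrite seriesSr; apply: ltr_wpDl => //.
  by rewrite sumr_ge0 // => j _; rewrite mulr_ge0 // ltW.
exists [set y | 0 < den y], (fun y => \row_i (num i y / den y)); split.
- rewrite openE => x /= x0; apply/nbhs_ballP; exists (den x) => //= y.
  rewrite -ball_normE /= => xy; have := le_lt_trans (den_lip x y) xy.
  by rewrite ltr_norml => /andP[_]; lra.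
- exact: Epos.
- move=> x /= x0; exists (den x / 2), (2 / (den x / 2) ^+ 2).
  split; first by rewrite divr_gt0.
  have lb y : `|x - y| < den x / 2 -> den x / 2 <= den y.
    move=> xy; have := le_lt_trans (den_lip x y) xy.
    by rewrite ltr_norml => /andP[_]; lra.
  move=> y z xy xz; apply/rV_norm_leP.
    by rewrite mulr_ge0 // divr_ge0 // exprn_ge0 //; lra.
  move=> i; rewrite !mxE; apply: quotient_lipschitz.
  + lra.
  + exact: lb.
  + exact: lb.
  + exact: (numP i y).2.
  + exact: (denP y).2.
  + exact: num_lip.
  + exact: den_lip.
- move=> x Ex.
  have d0 := Epos x Ex.
  suff H : `|\row_i (num i x / den x) - f x| <= eta / 2 by lra.
  apply/rV_norm_leP; first by lra.
  move=> i; rewrite !mxE.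
  have -> : num i x / den x - f x 0 i = (num i x - f x 0 i * den x) / den x.
    by field; rewrite gt_eqF.
  rewrite normrM normfV (ger0_norm (ltW d0)) ler_pdivrMr //.
  have -> : num i x - f x 0 i * den x =
      limn (series (fun k => c k * b k x * (v k 0 i - f x 0 i))).
    rewrite /num /den /bump_sum.
    rewrite (_ : f x 0 i * _ = limn (series (f x 0 i *: (fun k => c k * b k x))));
      last by rewrite lim_seriesZ //; exact: (denP x).1.
    rewrite -lim_seriesB; last by apply: is_cvg_seriesZ; exact: (denP x).1.
      congr (limn (series _)); apply/funext => k.
      rewrite -[LHS]/(c k * v k 0 i * b k x - f x 0 i * (c k * b k x)); ring.
    exact: (numP i x).1.
  have Hk k : `|c k * b k x * (v k 0 i - f x 0 i)| <=
      (eta / 2) * (c k * b k x).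
    rewrite normrM (ger0_norm (mulr_ge0 (ltW (c0 k)) (b0 k x))) mulrC.
    have [->|] := eqVneq (b k x) 0; first by rewrite !mulr0.
    move=> bx; apply: ler_wpM2r; first exact: mulr_ge0 (ltW (c0 k)) (b0 k x).
    move: bx; rewrite /b; case: asboolP => [Sk|]; last by rewrite eqxx.
    have [|lt _] := leP (r k - `|x - a k|) 0; first by rewrite eqxx.
    have [Ey ya] : touch k (xget 0 (touch k)).
      by apply: xgetPex; exists x; split => //; lra.
    have xa : `|x - a k| < r k by lra.
    have /ltW := Sk _ _ Ey Ex ya xa.
    apply: le_trans.
    have := rV_coord_le (v k - f x) i; rewrite !mxE; exact.
  have cvA := is_cvg_seriesZ (k := eta / 2) (denP x).1.
  have -> : eta / 2 * den x =
      limn (series ((eta / 2) *: (fun k => c k * b k x))).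
    by rewrite lim_seriesZ //; exact: (denP x).1.
  have cvT : cvgn [normed series (fun k => c k * b k x * (v k 0 i - f x 0 i))].
    apply: (series_le_cvg _ _ _ cvA) => k.
    - exact: normr_ge0.
    - have h := Hk k; apply: le_trans h; exact: normr_ge0.
    - exact: Hk.
  apply: (le_trans (lim_series_norm cvT)).
  by apply: lim_series_le => // k; exact: Hk.
Qed.

(** * Lipschitz images of hyperplane pieces and general position *)

Lemma rV_norm_attained (R : realType) n (v : 'rV[R]_n.+1) :
  exists i, `|v| = `|v 0 i|.
Proof.
have [v0|v0] := eqVneq `|v| 0.
  exists ord0; apply/eqP; rewrite eq_le rV_coord_le andbT v0; exact: normr_ge0.
have [[j i] /= H] := mx_norm_neq0 v0.
by exists i; rewrite [LHS]H ord1.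
Qed.

Lemma truncn_cell (R : realType) (x y d : R) : 0 < d -> 0 <= x -> 0 <= y ->
  Num.truncn (x / d) = Num.truncn (y / d) -> `|x - y| <= d.
Proof.
move=> d0 x0 y0 xy.
have /truncn_itv/andP[a b] : 0 <= x / d by rewrite divr_ge0 // ltW.
have /truncn_itv/andP[a' b'] : 0 <= y / d by rewrite divr_ge0 // ltW.
rewrite xy in a b; move: a b a' b'; set N := Num.truncn _.
rewrite !ler_pdivlMr // !ltr_pdivrMr // -natr1 mulrDl mul1r => *.
by rewrite ler_norml; apply/andP; split; lra.
Qed.

(** The count behind [lipschitz_hyperplane_avoid].  With m = (A+1)^(n+1),
    (A m + 1)^n <= ((A+1) m)^n = (A+1)^n m^n < m^(n+1). *)
Lemma grid_count (A n : nat) : (0 < A)%N ->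
  ((A * A.+1 ^ n.+1).+1 ^ n < (A.+1 ^ n.+1) ^ n.+1)%N.
Proof.
move=> A0; set m := (A.+1 ^ n.+1)%N.
have m0 : (0 < m)%N by rewrite expn_gt0.
have H : ((A * m).+1 <= A.+1 * m)%N by rewrite mulSn -addn1 addnC leq_add2r.
apply: (@leq_ltn_trans ((A.+1 * m) ^ n)).
  by case: n @m m0 H => // n m m0 H; rewrite leq_exp2r.
by rewrite expnMn [X in (_ < X)%N]expnS ltn_pmul2r ?expn_gt0 ?m0 // ltn_exp2l.
Qed.


(** Row vectors form a complete normed module, as the Baire category theorem
    requires. *)
HB.instance Definition _ (R : realType) (m n : nat) :=
  Uniform_isComplete.Build 'M[R]_(m, n) cauchy_cvg.

(** Box counting.  If the image of K contained a cube, the m^(n+1) points of a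
    grid of mesh eta / m in it would have preimages in K.  Cut K, which is
    n-dimensional, into about (A m)^n cells with A proportional to the
    Lipschitz constant: two preimages in one cell would have images closer than
    the mesh, and for large m there are more grid points than cells. *)
Lemma lipschitz_hyperplane_avoid (R : realType) n (K : set 'rV[R]_n.+1)
    (G : 'rV[R]_n.+1 -> 'rV[R]_n.+1) (i : 'I_n.+1) (t : R) (q : 'rV[R]_n.+1)
    (s L : R) :
  (forall y, K y -> y 0 i = t /\ `|y - q| <= s) ->
  (forall y z, K y -> K z -> `|G y - G z| <= L * `|y - z|) ->
  forall (c0 : 'rV[R]_n.+1) (eta : R), 0 < eta ->
  exists c, `|c - c0| < eta /\ forall y, K y -> G y <> c.
Proof.
move=> Kflat Glip c0 eta eta0; apply: contrapT => noc.
have hit c : `|c - c0| < eta -> exists y, K y /\ G y = c.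
  move=> cc; apply: contrapT => H; apply: noc; exists c; split => // y Ky Gy.
  by apply: H; exists y.
pose s1 := `|s| + 1; pose L1 := `|L| + 1.
have s10 : 0 < s1 by rewrite ltr_wpDl.
have L10 : 0 < L1 by rewrite ltr_wpDl.
(* The cells of K have side 2 s1 / (A m), so their images have diameter at most
   2 s1 L1 / (A m), which is below the mesh eta / m. *)
pose A := (Num.truncn (2 * s1 * L1 / eta)).+1.
have HA : 2 * s1 * L1 / eta < A%:R by exact: truncnS_gt.
pose m := (A.+1 ^ n.+1)%N.
have m0 : (0 < m)%N by rewrite expn_gt0.
have m0' : 0 < m%:R :> R by rewrite ltr0n.
pose c (phi : {ffun 'I_n.+1 -> 'I_m}) : 'rV[R]_n.+1 :=
  c0 + \row_j (eta * (phi j)%:R / m%:R).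
have cc phi : `|c phi - c0| < eta.
  rewrite /c addrAC subrr add0r; apply/rV_norm_ltP => // j; rewrite !mxE.
  rewrite (ger0_norm (divr_ge0 (mulr_ge0 (ltW eta0) (ler0n _ _)) (ltW m0'))).
  rewrite ltr_pdivrMr //.
  by rewrite ltr_pM2l // ltr_nat.
pose y phi := projT1 (cid (hit _ (cc phi))).
have Ky phi : K (y phi) by rewrite /y; case: cid => ? [].
have Gy phi : G (y phi) = c phi by rewrite /y; case: cid => ? [].
have Am0 : (0 < A * m)%N by rewrite muln_gt0.
pose d := 2 * s1 / (A * m)%:R.
have d0 : 0 < d by rewrite divr_gt0 ?mulr_gt0 ?ltr0n.
pose w phi j := y phi 0 j - q 0 j + s1.
have w0 phi j : 0 <= w phi j <= 2 * s1.
  have := rV_coord_le (y phi - q) j; rewrite !mxE.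
  move=> /le_trans/(_ (Kflat _ (Ky phi)).2).
  have := ler_norm s; rewrite /w /s1 => h1; rewrite ler_norml => /andP[h2 h3].
  by apply/andP; split; lra.
have cell phi j : (Num.truncn (w phi j / d) < (A * m).+1)%N.
  have /andP[a b] := w0 phi j.
  have wd0 : 0 <= w phi j / d by rewrite divr_ge0 // ltW.
  rewrite ltnS -(ler_nat R); have /truncn_itv/andP[h _] := wd0.
  apply: (le_trans h); rewrite ler_pdivrMr // /d mulrC divfK //.
  by rewrite pnatr_eq0 -lt0n.
(* Only the n coordinates that vary on K index the cells. *)
pose psi phi : {ffun 'I_n -> 'I_(A * m).+1} :=
  [ffun j => Ordinal (cell phi (lift i j))].
have psi_inj : injective psi.
  move=> phi1 phi2 psi12.
  have close : `|y phi1 - y phi2| <= d.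
    apply/rV_norm_leP; first exact: ltW.
    move=> j; rewrite !mxE; case: (unliftP i j) => [j' ->|->].
      have := congr1 (fun f : {ffun _} => nat_of_ord (f j')) psi12.
      rewrite !ffunE /=.
      have /andP[a1 _] := w0 phi1 (lift i j').
      have /andP[a2 _] := w0 phi2 (lift i j').
      move=> /(truncn_cell d0 a1 a2); rewrite /w.
      congr (_ <= _); congr (`|_|); ring.
    by rewrite (Kflat _ (Ky phi1)).1 (Kflat _ (Ky phi2)).1 subrr normr0 ltW.
  have : `|c phi1 - c phi2| < eta / m%:R.
    rewrite -!Gy; apply: (le_lt_trans (Glip _ _ (Ky _) (Ky _))).
    apply: (@le_lt_trans _ _ (L1 * d)).
      apply: (@le_trans _ _ (L1 * `|y phi1 - y phi2|)).
        by rewrite ler_wpM2r // /L1; have := ler_norm L; lra.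
      by rewrite ler_wpM2l // ltW.
    rewrite ltr_pdivlMr // /d natrM invfM.
    have -> : L1 * (2 * s1 * (A%:R^-1 / m%:R)) * m%:R = 2 * s1 * L1 / A%:R.
      by field; rewrite !gt_eqF // ltr0n.
    by rewrite ltr_pdivrMr ?ltr0n // [eta * _]mulrC -ltr_pdivrMr.
  move=> /(rV_norm_ltP _ _) -/(_ (divr_gt0 eta0 m0')) H.
  apply/ffunP => j; apply/val_inj => /=.
  have := H j; rewrite !mxE opprD addrACA subrr add0r -mulrBl -mulrBr.
  rewrite normrM normfV (ger0_norm (ltW m0')) ltr_pdivrMr // divfK ?gt_eqF //.
  rewrite normrM (ger0_norm (ltW eta0)) -[ltRHS]mulr1 ltr_pM2l //.
  rewrite ltr_norml => /andP[h1 h2].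
  case: (ssrnat.ltngtP (phi1 j) (phi2 j)) => //; rewrite -(ler_nat R) -natr1 => h;
    exfalso; lra.
have := leq_card psi psi_inj; rewrite !card_ffun !card_ord.
by rewrite leqNgt grid_count.
Qed.

Lemma lipschitz_image_compact (R : realType) m n (K : set 'rV[R]_m)
    (G : 'rV[R]_m -> 'rV[R]_n) (L : R) :
  (forall y z, K y -> K z -> `|G y - G z| <= L * `|y - z|) ->
  compact K -> compact (G @` K).
Proof.
move=> Glip cK; apply: continuous_compact => //.
apply/within_contP => x Kx; apply/cvgrPdist_lt => e e0.
have L0 : 0 < `|L| + 1 by rewrite ltr_wpDl.
apply/nbhs_ballP; exists (e / (`|L| + 1)); first exact: divr_gt0.
move=> y; rewrite -ball_normE /= => xy Ky.
apply: (le_lt_trans (Glip _ _ Kx Ky)).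
apply: (@le_lt_trans _ _ ((`|L| + 1) * `|x - y|)).
  by rewrite ler_wpM2r //; have := ler_norm L; lra.
by rewrite mulrC -ltr_pdivlMr.
Qed.

Lemma dist_continuous (R : realType) (V : normedModType R) (q : V) :
  continuous (fun y : V => `|y - q|).
Proof.
by move=> y; apply: cvg_norm; apply: cvgB; [exact: cvg_id | exact: cvg_cst].
Qed.

Lemma closed_norm_ball (R : realType) (V : normedModType R) (q : V) (s : R) :
  closed [set y : V | `|y - q| <= s].
Proof.
apply: (@closed_comp _ _ (fun y : V => `|y - q|) [set t | t <= s]).
  by move=> y _; exact: dist_continuous.
exact: closed_le.
Qed.

Lemma compact_norm_ball (R : realType) n (q : 'rV[R]_n) (s : R) :
  compact [set y : 'rV[R]_n | `|y - q| <= s].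
Proof.
apply: bounded_closed_compact; last exact: closed_norm_ball.
exists (s + `|q|); split; first exact: num_real.
move=> M hM y /= yq; apply: ltW; apply: le_lt_trans hM.
rewrite -[y](subrK q); apply: (le_trans (ler_normD _ _)); exact: lerD.
Qed.

(** General position.  A sup-norm sphere lies in the hyperplanes that carry its
    faces.  Cut by rational balls on which G is Lipschitz, these give countably
    many compact pieces; their images are closed with dense complement, and by
    the Baire theorem some small c avoids all of them. *)
Lemma lipschitz_avoid_spheres (R : realType) n (U : set 'rV[R]_n.+1)
    (G : 'rV[R]_n.+1 -> 'rV[R]_n.+1) (p : nat -> 'rV[R]_n.+1) (r : nat -> R)
    (eta : R) : locally_lipschitz U G -> 0 < eta ->
  exists c, `|c| < eta /\ forall k y, U y -> `|y - p k| = r k -> G y <> c.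
Proof.
move=> Glip eta0.
pose T := ('I_n.+1 * bool * nat * 'rV[rat]_n.+1 * rat)%type.
pose Kball (q : 'rV[rat]_n.+1) (s : rat) : set 'rV[R]_n.+1 :=
  [set y | `|y - map_mx ratr q| <= ratr s].
pose lip q s := exists L : R, forall y z, Kball q s y -> Kball q s z ->
  `|G y - G z| <= L * `|y - z|.
pose K (t : T) : set 'rV[R]_n.+1 :=
  let: (i, b, k, q, s) := t in
  [set y : 'rV[R]_n.+1 | lip q s /\ y 0 i = p k 0 i + (-1) ^+ b * r k]
  `&` Kball q s.
pose F m : set 'rV[R]_n.+1 :=
  if (unpickle m : option T) is Some t then ~` (G @` K t) else setT.
have [|||c [] ] := @Baire R 'rV[R]_n.+1 F _ [set c | `|c - 0| < eta] _ _.
- move=> m; rewrite /F; case: unpickle => [[[[[i b] k] q] s]|]; last first.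
    by split; [exact: openT | move=> O O0 _; rewrite setIT].
  case: (pselect (lip q s)) => [[L HL]|nl]; last first.
    rewrite (_ : K _ = set0).
      rewrite image_set0 setC0.
      by split; [exact: openT | move=> O O0 _; rewrite setIT].
    by apply/seteqP; split => // y [[]].
  split.
    rewrite openC; apply: compact_closed; first exact: norm_hausdorff.
    apply: (@lipschitz_image_compact _ _ _ _ _ L).
      by move=> y z [_ Ky] [_ Kz]; exact: HL.
    apply: (@subclosed_compact _ _ (Kball q s)).
    + apply: closedI; last exact: closed_norm_ball.
      rewrite (_ : [set y | _] =
          (fun y : 'rV[R]_n.+1 => y 0 i) @^-1` [set p k 0 i + (-1) ^+ b * r k]).
        apply: closed_comp; last exact: closed_eq.
        by move=> y _; exact: coord_continuous.
      apply/seteqP; split => y /=; first by case.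
      by move=> ?; split => //; exists L.
    + exact: compact_norm_ball.
    + by move=> y [].
  move=> O [c0 Oc0] oO.
  have /nbhs_ballP[d /= d0 Od] : nbhs c0 O by exact: open_nbhs_nbhs.
  have [||c [cc Hc]] := @lipschitz_hyperplane_avoid R n (K (i, b, k, q, s)) G i
    (p k 0 i + (-1) ^+ b * r k) (map_mx ratr q) (ratr s) L _ _ c0 d d0.
  + by move=> y [[_ ->]].
  + by move=> y z [_ Ky] [_ Kz]; exact: HL.
  exists c; split.
    by apply: Od; rewrite -ball_normE /= distrC.
  by move=> [y Ky Gy]; exact: Hc Gy.
- by exists 0; rewrite /= subr0 normr0.
- rewrite (_ : mkset _ = ball (0 : 'rV[R]_n.+1) eta); first exact: ball_open.
  by apply/seteqP; split => y; rewrite -ball_normE /= distrC.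
move=> cc Hc; exists c; split; first by move: cc; rewrite /= subr0.
move=> k y Uy yp Gy.
have [d [L [d0 HL]]] := Glip y Uy.
have /rat_in_itvoo[s] : d / 4 < d / 2 by lra.
rewrite in_itv /= => /andP[s1 s2].
have s0 : 0 < ratr s :> R by lra.
have [q Hq] := @rat_rV_dense R _ y _ s0.
have [i Hi] := rV_norm_attained (y - p k).
have [b Hb] : exists b : bool, y 0 i = p k 0 i + (-1) ^+ b * r k.
  move: Hi; rewrite yp !mxE => ->.
  case: (ger0P (y 0 i - p k 0 i)) => _; [exists false|exists true] => /=.
    by rewrite expr0; lra.
  by rewrite expr1; lra.
have := Hc (pickle ((i, b, k, q, s) : T)) I; rewrite /F pickleK; apply.
exists y => //; split; last by apply: ltW.
have near z : Kball q s z -> `|y - z| < d.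
  rewrite /Kball /= => zq; rewrite -(subrKA (map_mx ratr q)).
  apply: (le_lt_trans (ler_normD _ _)); rewrite [in X in _ + X]distrC; lra.
by split => //; exists L => z z' /near yz /near yz'; exact: HL.
Qed.

(** * Capped distance and dense families of cubes *)

(** The distance to A capped at 1; thanks to the cap it is a real 1-Lipschitz
    function for every A, also for the empty set. *)
Section capped_distance.
Context (R : realType) (V : normedModType R) (A : set V).
Implicit Types y z p : V.

Definition cdist y : R := inf ([set 1] `|` [set `|y - p| | p in A]).

Let cdist_has_inf y : has_inf ([set 1] `|` [set `|y - p| | p in A]).
Proof.
split; first by exists 1; left.
by exists 0 => _ [->|[p _ <-]]; [exact: ler01 | exact: normr_ge0].
Qed.

Lemma cdist_ge0 y : 0 <= cdist y.
Proof.
apply: lb_le_inf; first exact: (cdist_has_inf y).1.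
by move=> _ [->|[p _ <-]]; [exact: ler01 | exact: normr_ge0].
Qed.

Lemma cdist_le1 y : cdist y <= 1.
Proof. by apply: ge_inf; [exact: (cdist_has_inf y).2 | left]. Qed.

Lemma cdist_le y p : A p -> cdist y <= `|y - p|.
Proof.
by move=> Ap; apply: ge_inf; [exact: (cdist_has_inf y).2 | right; exists p].
Qed.

Lemma cdist_notin y z : `|y - z| < cdist y -> ~ A z.
Proof. by move=> yz /(cdist_le y); rewrite leNgt yz. Qed.

Lemma cdist_lt y a : a <= 1 -> cdist y < a -> exists2 p, A p & `|y - p| < a.
Proof.
move=> a1 /(inf_lt (cdist_has_inf y).1)[_ [->|[p Ap <-]]]; last by exists p.
by rewrite ltNge a1.
Qed.

Let cdist_leD y z : cdist y <= cdist z + `|y - z|.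
Proof.
rewrite -lerBlDr; apply: lb_le_inf; first exact: (cdist_has_inf z).1.
move=> _ [->|[p Ap <-]].
  by rewrite lerBlDr; apply: (le_trans (cdist_le1 _)); rewrite lerDl.
rewrite lerBlDr; apply: (le_trans (cdist_le y Ap)).
by rewrite [leRHS]addrC -[y - p](subrKA z) ler_normD.
Qed.

Lemma cdist_lipschitz y z : `|cdist y - cdist z| <= `|y - z|.
Proof.
rewrite ler_distl; apply/andP; split; last exact: cdist_leD.
by rewrite lerBlDr distrC; exact: cdist_leD.
Qed.

Lemma cdist_continuous : continuous cdist.
Proof.
move=> y; apply/cvgrPdist_lt => e e0; apply/nbhs_ballP; exists e => // z.
by rewrite -ball_normE /=; exact: le_lt_trans (cdist_lipschitz _ _).
Qed.

Lemma cdist_gt0 y : open (~` A) -> ~ A y -> 0 < cdist y.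
Proof.
move=> oA Ay; have /nbhs_ballP[d /= d0 yd] : nbhs y (~` A) by exact: open_nbhs_nbhs.
rewrite lt_neqAle cdist_ge0 andbT; apply/eqP => H.
have [||p Ap yp] := @cdist_lt y (Num.min 1 d).
- by rewrite ge_min lexx.
- by rewrite -H lt_min ltr01 d0.
apply: (yd p) => //; rewrite -ball_normE /=; apply: (lt_le_trans yp).
by rewrite ge_min lexx orbT.
Qed.

End capped_distance.

Lemma cdist_subset (R : realType) (V : normedModType R) (A B : set V) y :
  A `<=` B -> cdist B y <= cdist A y.
Proof.
move=> AB; rewrite leNgt; apply/negP => H.
have [p Ap] := cdist_lt (cdist_le1 B y) H.
by rewrite ltNge cdist_le //; exact: AB.
Qed.

Lemma countable_avoid (R : realType) (u : nat -> R) (a b : R) : a < b ->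
  exists r, a < r < b /\ forall k, u k <> r.
Proof.
move=> ab; apply: contrapT => H.
have sub : `]a, b[%classic `<=` range u.
  move=> r; rewrite /= in_itv /= => rab; apply: contrapT => nr.
  by apply: H; exists r; split => // k uk; apply: nr; exists k.
have c : countable `]a, b[%classic.
  apply: (sub_countable (subset_card_le sub)).
  exact: sub_countable (card_image_le _ _) (countableP _).
have := countable_lebesgue_measure0 c.
rewrite lebesgue_measure_itv /= lte_fin ab EFinN -EFinB => -[] /eqP.
by rewrite subr_eq0 gt_eqF.
Qed.

(** Countably many cubes with centres dense in Y and radii dense in the
    positive reals.  As there are only countably many centres, the radii can be
    chosen so that no centre lies on the boundary of a cube of the family;
    pushing onto a boundary then never hits another centre. *)
Lemma dense_sphere_family (R : realType) n (Y : set 'rV[R]_n) : Y !=set0 ->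
  exists (p : nat -> 'rV[R]_n) (r : nat -> R),
  [/\ forall k, Y (p k), forall k, 0 < r k,
      forall j k, `|p j - p k| <> r k &
      forall y e a b, Y y -> 0 < e -> 0 <= a -> a < b ->
        exists k, `|y - p k| < e /\ a < r k < b].
Proof.
move=> [y0 Yy0].
pose T := ('rV[rat]_n * rat * rat * rat)%type.
pose code k : T := odflt (0, 0, 0, 0) (unpickle k).
pose near k := [set y : 'rV[R]_n | Y y /\
  `|y - map_mx ratr (code k).1.1.1| < ratr (code k).1.1.2].
pose p k := if pselect (near k !=set0) then xget y0 (near k) else y0.
pose a k : R := ratr (code k).1.2; pose b k : R := ratr (code k).2.
pose good k := 0 <= a k < b k.
have Hr k : exists r, [/\ 0 < r, forall j, `|p j - p k| <> r &
    good k -> a k < r < b k].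
  have [g|g] := boolP (good k).
    have /andP[a0 ab] := g.
    have [r [/andP[r1 r2] Hr]] := countable_avoid (fun j => `|p j - p k|) ab.
    by exists r; split => //; [exact: le_lt_trans r1 | move=> _; rewrite r1].
  have [r [/andP[r1 _] Hr]] := countable_avoid (fun j => `|p j - p k|) (@ltr01 R).
  by exists r; split => //; move/negP: g.
exists p, (fun k => projT1 (cid (Hr k))); split.
- move=> k; rewrite /p; case: pselect => // nk.
  by have [] := xgetPex y0 nk.
- by move=> k; case: cid => ? [].
- by move=> j k; case: cid => ? [].
- move=> y e a' b' Yy e0 a0 ab.
  have /rat_in_itvoo[s] : 0 < e / 2 by lra.
  rewrite in_itv /= => /andP[s1 s2].
  have [q Hq] := @rat_rV_dense R _ y _ s1.
  have /rat_in_itvoo[qa] : a' < (a' + b') / 2 by lra.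
  rewrite in_itv /= => /andP[qa1 qa2].
  have /rat_in_itvoo[qb] : (a' + b') / 2 < b' by lra.
  rewrite in_itv /= => /andP[qb1 qb2].
  pose k := pickle ((q, s, qa, qb) : T).
  have codek : code k = (q, s, qa, qb) by rewrite /code pickleK.
  exists k; split; last first.
    case: cid => r /= [r0 _]; rewrite /good /a /b codek /=.
    case/(_ _)/andP; first by apply/andP; split; lra.
    by move=> r1 r2; apply/andP; split; lra.
  have ny : near k y by split => //; rewrite codek.
  rewrite /p; case: pselect => [nk|[]]; last by exists y.
  have [_] := xgetPex y0 nk; rewrite codek /=; set x := xget _ _ => xq.
  rewrite -(subrKA (map_mx ratr q)); apply: (le_lt_trans (ler_normD _ _)).
  by rewrite [in X in _ + X]distrC; lra.
Qed.

(** * Pushing zeros out of cubes *)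

Section push.
Context (R : realType) (V : normedModType R) (p : V) (r : R).
Hypothesis r0 : 0 < r.
Implicit Type y : V.

(** The radial push from p onto the sphere of radius r: the identity outside the
    ball, discontinuous only at p. *)
Definition push y : V := p + (r / Num.min r `|y - p|) *: (y - p).

Lemma push_out y : r <= `|y - p| -> push y = y.
Proof.
by move=> ry; rewrite /push min_l // divff ?gt_eqF // scale1r addrC subrK.
Qed.

Lemma push_in y : y <> p -> `|y - p| <= r -> `|push y - p| = r.
Proof.
move=> yp yr; have y0 : 0 < `|y - p| by rewrite normr_gt0 subr_eq0; apply/eqP.
rewrite /push addrAC subrr add0r min_r // normrZ.
by rewrite ger0_norm ?divr_ge0 ?ltW // divfK // gt_eqF.
Qed.

Lemma push_continuous y : y <> p -> {for y, continuous push}.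
Proof.
move=> yp; have y0 : 0 < `|y - p| by rewrite normr_gt0 subr_eq0; apply/eqP.
have cB : (fun z => z - p) z @[z --> y] --> y - p.
  by apply: cvgB; [exact: cvg_id | exact: cvg_cst].
apply: cvgD; first exact: cvg_cst.
apply: cvgZ => //; apply: cvgM; first exact: cvg_cst.
apply: cvgV; first by rewrite gt_eqF // lt_min r0.
apply: (@continuous_min _ _ (fun _ => r) (fun z => `|z - p|)).
  exact: cvg_cst.
exact: dist_continuous.
Qed.

End push.

(** [adm] selects the cubes that may be used.  They lie in [N], where [F] is
    small in the application, their boundaries carry no zero of [F], and their
    interiors cover the zeros of [F].  The bound by the distance to the
    complement of [U] keeps the cubes that meet a small ball inside a compact
    subset of [U], which makes the process locally finite. *)
Section remove_zeros.
Context (R : realType) (n m : nat) (U N : set 'rV[R]_n)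
  (F : 'rV[R]_n -> 'rV[R]_m) (p : nat -> 'rV[R]_n) (r : nat -> R)
  (adm : nat -> Prop).
Hypothesis U_open : open U.
Hypothesis F_cont : forall y, U y -> {for y, continuous F}.
Hypothesis r_gt0 : forall k, 0 < r k.
Hypothesis p_sphere : forall j k, `|p j - p k| <> r k.
Hypothesis adm_N : forall k, adm k -> forall y, `|y - p k| <= r k -> N y.
Hypothesis NU : N `<=` U.
Hypothesis adm_small : forall k, adm k -> 4 * r k < cdist (~` U) (p k).
Hypothesis F_sphere :
  forall k y, adm k -> U y -> `|y - p k| = r k -> F y <> 0.
Hypothesis F_cover :
  forall y, U y -> F y = 0 -> exists k, adm k /\ `|y - p k| < r k.

Let V := [set y | U y /\ ~ range p y].

Let hit k (g : 'rV[R]_n -> 'rV[R]_m) :=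
  adm k /\ exists z, [/\ V z, `|z - p k| < r k & g z = 0].

(** Cube k is used only if it still contains a zero; otherwise large cubes could
    change the map near a given point infinitely often. *)
Fixpoint pushes k : 'rV[R]_n -> 'rV[R]_m :=
  if k is k'.+1 then
    if `[< hit k' (pushes k') >] then pushes k' \o push (p k') (r k')
    else pushes k'
  else F.

Let adm_U k y : adm k -> `|y - p k| <= r k -> U y.
Proof. by move=> /adm_N H /H /NU. Qed.

Let push_V k y : adm k -> V y -> V (push (p k) (r k) y).
Proof.
move=> ak [Uy py]; have yp : y <> p k by move=> H; apply: py; exists k.
have [ry|yr] := leP (r k) `|y - p k|; first by rewrite push_out.
have H := push_in (r_gt0 k) yp (ltW yr).
split; first by apply: (adm_U ak); rewrite H.
by move=> [j _ E]; apply: (@p_sphere j k); rewrite E.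
Qed.

(** A zero y of the k-th map is a zero of [F] outside the cubes treated so far:
    a new zero in the cube would come from a zero on its boundary, but zeros are
    never created and [F] has none there. *)
Let pushes_zero k y : V y -> pushes k y = 0 ->
  F y = 0 /\ forall i, (i < k)%N -> adm i -> r i <= `|y - p i|.
Proof.
elim: k y => [|k IH] y Vy /=; first by move=> ->; split.
case: asboolP => [[ak _]|nh].
  have [ry|yr] := leP (r k) `|y - p k|.
    rewrite /= push_out // => /(IH _ Vy)[Fy H]; split => // i.
    by rewrite ltnS leq_eqVlt => /orP[/eqP ->//|/H].
  have yp : y <> p k by move=> H; apply: Vy.2; exists k.
  have S := push_in (r_gt0 k) yp (ltW yr).
  have W := push_V ak Vy.
  by move=> /(IH _ W)[Fw _]; case: (F_sphere ak W.1 S).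
move=> gy; have [Fy H] := IH _ Vy gy; split => // i.
rewrite ltnS leq_eqVlt => /orP[/eqP -> ak|/H//].
by rewrite leNgt; apply/negP => yk; apply: nh; split => //; exists y.
Qed.

Let pushes_cont k y : V y -> {for y, continuous (pushes k)}.
Proof.
elim: k y => [|k IH] y Vy /=; first by apply: F_cont; exact: Vy.1.
case: asboolP => [[ak _]|_]; last exact: IH.
apply: continuous_comp; last by apply: IH; exact: push_V.
by apply: push_continuous => // H; apply: Vy.2; exists k.
Qed.

(** Pushing replaces a value taken in a cube, hence in [N], by a value at a
    boundary point of the cube, again in [N]. *)
Let pushes_val k y : V y ->
  pushes k y = F y \/ (N y /\ exists2 y', N y' & pushes k y = F y').
Proof.
elim: k y => [|k IH] y Vy /=; first by left.
case: asboolP => [[ak _]|_]; last exact: IH.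
have [ry|yr] := leP (r k) `|y - p k|; first by rewrite /= push_out //; exact: IH.
have yp : y <> p k by move=> H; apply: Vy.2; exists k.
have S := push_in (r_gt0 k) yp (ltW yr).
right; split; first exact: adm_N ak _ (ltW yr).
have [E|[_ [y' Ny' E]]] := IH _ (push_V ak Vy); last by exists y'.
by exists (push (p k) (r k) y) => //; apply: (adm_N ak); rewrite S.
Qed.

(** The cubes meeting a small ball around y lie in a compact ball K in [U].
    Finitely many cubes cover the zeros of [F] in K; once they have been
    treated, no zero is left in K, so every later cube that meets the small ball
    is skipped. *)
Let pushes_stable y : U y -> exists (J : nat) (d : R), 0 < d /\
  forall k w, (J <= k)%N -> `|w - y| < d -> pushes k w = pushes J w.
Proof.
move=> Uy; pose m0 := cdist (~` U) y.
have m_gt0 : 0 < m0 by apply: cdist_gt0; [by rewrite setCK | exact].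
(* A cube of radius r with 4 r < m0 + dist(p, y) that meets the ball of radius
   m0 / 8 has r < 3 m0 / 8, hence lies within 7 m0 / 8 of y. *)
pose K := [set z : 'rV[R]_n | `|z - y| <= 7 / 8 * m0].
have KU : K `<=` U.
  move=> z Kz; apply: contrapT; apply: (@cdist_notin _ _ (~` U) y z).
  by rewrite distrC; apply: (le_lt_trans Kz); rewrite -/m0; lra.
have cZ : compact (K `&` F @^-1` [set 0]).
  apply: (subclosed_compact _ (@compact_norm_ball _ _ y (7 / 8 * m0))) => //.
  rewrite -openC openE => z Hz.
  have [Kz|nK] := pselect (K z); last first.
    have oK : open (~` K) by rewrite openC; exact: closed_norm_ball.
    apply: filterS (open_nbhs_nbhs (conj oK nK)) => w nw [] //.
  have Fz : F z != 0 by apply/eqP => H; apply: Hz.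
  have cz := F_cont (KU _ Kz).
  have : \forall w \near z, F w != 0.
    exact: cvgr_neq0 cz Fz.
  by apply: filterS => w /eqP Fw [_ /=].
have := cZ; rewrite compact_cover => /(_ nat adm (fun k => ball (p k) (r k))).
case=> [k _|z [Kz Fz]|D DJ Dc]; first exact: ball_open.
  have [k [ak zk]] := F_cover (KU _ Kz) Fz.
  by exists k => //; rewrite -ball_normE /= distrC.
have [J HJ] : exists J, forall i, i \in finmap.enum_fset D -> (i < J)%N.
  exists (\max_(i <- finmap.enum_fset D) i).+1 => i iD.
  by rewrite ltnS; exact: leq_bigmax_seq.
exists J, (m0 / 8); split; first lra.
move=> k w; elim: k => [|k IH]; first by rewrite leqn0 => /eqP ->.
rewrite leq_eqVlt => /orP[/eqP -> //|]; rewrite ltnS => Jk wy /=.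
rewrite -IH //; case: asboolP => // -[ak [z [Vz zp gz]]] /=.
rewrite push_out // leNgt; apply/negP => wp.
have [Fz Hz] := pushes_zero Vz gz.
have cl : cdist (~` U) (p k) <= m0 + `|p k - y|.
  by have := cdist_lipschitz (~` U) (p k) y; rewrite ler_norml => /andP[_]; lra.
have t1 : `|p k - y| <= `|w - p k| + `|w - y|.
  by rewrite -[p k - y](subrKA w) [`|w - p k|]distrC ler_normD.
have t2 : `|z - y| <= `|z - p k| + `|p k - y|.
  by rewrite -[z - y](subrKA (p k)) ler_normD.
have ra := adm_small ak.
have Kz : K z by rewrite /K /=; lra.
have [i iD] := Dc z (conj Kz Fz).
rewrite -ball_normE /= distrC ltNge Hz //.
  by apply: leq_trans Jk; exact: HJ.
by have := DJ i iD; rewrite inE.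
Qed.

Lemma remove_zeros : exists g : 'rV[R]_n -> 'rV[R]_m,
  forall y, U y -> ~ range p y ->
  [/\ {for y, continuous g}, g y <> 0 &
      g y = F y \/ (N y /\ exists2 y', N y' & g y = F y')].
Proof.
pose J y :=
  if pselect (U y) is left Uy then projT1 (cid (pushes_stable Uy)) else 0%N.
have stable y : U y -> exists d : R, 0 < d /\
  forall k w, (J y <= k)%N -> `|w - y| < d -> pushes k w = pushes (J y) w.
  by move=> Uy; rewrite /J; case: pselect => // Uy'; case: cid.
exists (fun y => pushes (J y) y) => y Uy py; have Vy : V y by [].
have gE k : (J y <= k)%N -> pushes k y = pushes (J y) y.
  move=> Jk; have [d [d0 H]] := stable y Uy.
  by apply: H => //; rewrite subrr normr0.
split.
- have [d [d0 Hd]] := stable y Uy.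
  have : \forall w \near y, pushes (J y) w = pushes (J w) w.
    have : \forall w \near y, U w /\ `|w - y| < d.
      apply: filterI; first exact: open_nbhs_nbhs.
      apply/nbhs_ballP; exists d => // w; by rewrite -ball_normE /= distrC.
    apply: filterS => w [Uw wy].
    have [d' [d'0 H]] := stable w Uw.
    rewrite -(Hd (maxn (J y) (J w))) ?leq_maxl // H ?leq_maxr //.
    by rewrite subrr normr0.
  have c : pushes (J y) @ y --> pushes (J y) y := pushes_cont Vy.
  by move=> E; apply: cvg_trans (near_eq_cvg E) c.
- move=> g0; have [Fy H] := pushes_zero Vy g0.
  have [k [ak yk]] := F_cover Uy Fy.
  have g0' : pushes (maxn (J y) k.+1) y = 0 by rewrite gE ?leq_maxl.
  have [_ /(_ k)] := pushes_zero Vy g0'.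
  by rewrite leq_maxr => /(_ isT ak); rewrite leNgt yk.
- exact: pushes_val.
Qed.

End remove_zeros.

(** * Pointwise continuity *)

Lemma locally_lipschitz_continuous (R : realType) (V W : normedModType R)
    (U : set V) (F : V -> W) y :
  locally_lipschitz U F -> U y -> {for y, continuous F}.
Proof.
move=> lF Uy; have [s [k [s0 H]]] := lF y Uy.
have k0 : 0 < `|k| + 1 by rewrite ltr_wpDl.
apply/cvgrPdist_lt => e e0; apply/nbhs_ballP.
exists (Num.min s (e / (`|k| + 1))); first by rewrite /= lt_min s0 divr_gt0.
move=> z; rewrite -ball_normE /= lt_min => /andP[zs ze].
have := H y z; rewrite subrr normr0 => /(_ s0 zs) /le_lt_trans; apply.
apply: (@le_lt_trans _ _ ((`|k| + 1) * `|y - z|)).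
  by rewrite ler_wpM2r //; have := ler_norm k; lra.
by rewrite mulrC -ltr_pdivlMr.
Qed.

Lemma within_continuousT (T U : topologicalType) (A : set T) (f : T -> U) :
  (forall x, A x -> {for x, continuous f}) -> {within A, continuous f}.
Proof.
move=> H; apply/within_contP => x Ax.
by apply: cvg_trans (H x Ax); apply: cvg_app; exact: cvg_within.
Qed.

Lemma within_continuous_interior (T U : topologicalType) (A : set T)
    (f : T -> U) x :
  {within A, continuous f} -> A° x -> {for x, continuous f}.
Proof.
move=> /within_contP H Ax; have := H x (interior_subset Ax).
rewrite /prop_for /continuous_at.
suff -> : within A (nbhs x) = nbhs x by [].
apply/seteqP; split => B; last exact: cvg_within.
by move=> wB; apply: filterS2 Ax wB => y Ay; apply.
Qed.

Section pointwise_continuity.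
Context (R : realType) (T : topologicalType) (V : normedModType R) (y : T).
Implicit Types (u v : T -> R) (f g : T -> V).

Lemma cont_cst (U : topologicalType) (c : U) : {for y, continuous (fun _ : T => c)}.
Proof. exact: cst_continuous. Qed.

Lemma contD f g : {for y, continuous f} -> {for y, continuous g} ->
  {for y, continuous (fun z => f z + g z)}.
Proof. by move=> cf cg; apply: cvgD. Qed.

Lemma contB f g : {for y, continuous f} -> {for y, continuous g} ->
  {for y, continuous (fun z => f z - g z)}.
Proof. by move=> cf cg; apply: cvgB. Qed.

Lemma contZ u f : {for y, continuous u} -> {for y, continuous f} ->
  {for y, continuous (fun z => u z *: f z)}.
Proof. by move=> cu cf; apply: cvgZ. Qed.

Lemma cont_norm f : {for y, continuous f} ->
  {for y, continuous (fun z => `|f z|)}.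
Proof. by move=> cf; apply: cvg_norm. Qed.

Lemma contBr u v : {for y, continuous u} -> {for y, continuous v} ->
  {for y, continuous (fun z => u z - v z)}.
Proof. by move=> cu cv; apply: cvgB. Qed.

Lemma contM u v : {for y, continuous u} -> {for y, continuous v} ->
  {for y, continuous (fun z => u z * v z)}.
Proof. by move=> cu cv; apply: cvgM. Qed.

Lemma contV u : u y != 0 -> {for y, continuous u} ->
  {for y, continuous (fun z => (u z)^-1)}.
Proof. by move=> u0 cu; apply: cvgV. Qed.

Lemma cont_min u v : {for y, continuous u} -> {for y, continuous v} ->
  {for y, continuous (fun z => Num.min (u z) (v z))}.
Proof. exact: continuous_min. Qed.

Lemma cont_max u v : {for y, continuous u} -> {for y, continuous v} ->
  {for y, continuous (fun z => Num.max (u z) (v z))}.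
Proof. exact: continuous_max. Qed.

End pointwise_continuity.

(** * The theorem for subsets of Euclidean space *)

(** The scale a governs everything: at a point z with |F0 z| < 1/10 it is a
    fraction of the distance to the complement of N, so a cube of size a around
    z stays in N.  Where the distance e to Y is at least a, no point of Y is
    available within reach; such points are interior to E, and there F1 = f and
    the perturbation is smaller than |F1|.  Hence zeros of F3 satisfy e < a. *)
Lemma euclidean_zero_free (R : realType) n (E : set 'rV[R]_n.+1)
    (f : 'rV[R]_n.+1 -> 'rV[R]_n.+1) :
  {within E, continuous f} -> (forall x, E° x -> f x <> 0) ->
  exists g : 'rV[R]_n.+1 -> 'rV[R]_n.+1,
  [/\ {within E, continuous g}, forall x, E x -> g x <> 0 &
      forall x, E x -> `|g x - f x| < 1].
Proof.
move=> cf f0; pose Y := ~` E.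
have [Yn|/set0P/negP/negPn/eqP Y0] := pselect (Y !=set0); last first.
  have ET : E = setT by rewrite -[E]setCK -/Y Y0 setC0.
  exists f; split => // x _.
    by apply: f0; rewrite ET interiorT.
  by rewrite subrr normr0.
have c20 : 0 < 20^-1 :> R by rewrite invr_gt0.
have [U [F0 [oU EU lF0 F0f]]] := lipschitz_approx c20 cf.
have cF0 y : U y -> {for y, continuous F0}.
  exact: locally_lipschitz_continuous.
pose N := [set y | U y /\ `|F0 y| < 1 / 5].
have NU : N `<=` U by move=> y [].
have oN : open N.
  rewrite openE => y [Uy Fy]; apply: filterI; first exact: open_nbhs_nbhs.
  exact: cvgr_norm_lt (cF0 y Uy) _ Fy.
pose e := cdist Y; pose b := cdist (~` N).
have ce : continuous e by exact: cdist_continuous.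
have cb : continuous b by exact: cdist_continuous.
have e_ge0 y : 0 <= e y by exact: cdist_ge0.
have e_int y : 0 < e y -> E° y.
  move=> ey; apply/nbhs_ballP; exists (e y) => // z; rewrite -ball_normE /=.
  by move=> /cdist_notin nYz; apply: contrapT.
(* The second term keeps a positive on U off N and is negative at zeros of maps that
   are 1/10-close to F0. *)
pose a y := Num.max (b y / 16) (`|F0 y| - 1 / 10).
have a_gt0 y : U y -> 0 < a y.
  move=> Uy; rewrite /a lt_max; have [Fy|Fy] := ltP `|F0 y| (1 / 5).
    apply/orP; left; rewrite divr_gt0 //; apply: cdist_gt0; first by rewrite setCK.
    exact.
  by apply/orP; right; lra.
have ca y : U y -> {for y, continuous a}.
  move=> Uy; apply: cont_max; first by apply: contM; [exact: cb | exact: cont_cst].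
  by apply: contBr; [apply: cont_norm; exact: cF0 | exact: cont_cst].
(* chi is 1 where e >= a and 0 where e <= a / 2, in particular near Y, where f
   is uncontrolled. *)
pose chi y : R := Num.min 1 (Num.max 0 (2 * e y / a y - 1)).
have cchi' y : U y -> {for y, continuous (fun z => 2 * e z / a z - 1)}.
  move=> Uy; apply: contBr; last exact: cont_cst.
  apply: contM; first by apply: contM; [exact: cont_cst | exact: ce].
  by apply: contV; [rewrite gt_eqF // a_gt0 | exact: ca].
have cchi y : U y -> {for y, continuous chi}.
  move=> Uy; apply: cont_min; first exact: cont_cst.
  by apply: cont_max; [exact: cont_cst | exact: cchi'].
have chi01 y : 0 <= chi y <= 1.
  by rewrite /chi le_min ler01 ge_min lexx le_max lexx.
have chi0 y : 2 * e y / a y - 1 <= 0 -> chi y = 0.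
  by move=> H; rewrite /chi max_l // min_r.
have chi_pos y : U y -> chi y <> 0 -> 0 < e y.
  move=> Uy; apply: contra_notT; rewrite -leNgt => ey; apply: chi0.
  have -> : e y = 0 by apply/eqP; rewrite eq_le ey e_ge0.
  by rewrite mulr0 mul0r; lra.
have chi1 y : U y -> a y <= e y -> chi y = 1.
  move=> Uy ae; rewrite /chi min_l // le_max; apply/orP; right.
  have : 1 <= e y / a y by rewrite ler_pdivlMr ?a_gt0 // mul1r.
  by rewrite -mulrA; lra.
pose F1 y := F0 y + chi y *: (f y - F0 y).
have cF1 y : U y -> {for y, continuous F1}.
  move=> Uy; have [ey|ey] := ltP 0 (e y).
    have cfy := within_continuous_interior cf (e_int y ey).
    apply: contD; first exact: cF0.
    by apply: contZ; [exact: cchi | apply: contB => //; exact: cF0].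
  have e0 : e y = 0 by apply/eqP; rewrite eq_le ey e_ge0.
  have : \forall z \near y, 2 * e z / a z - 1 < 0.
    have lt0 : 2 * e y / a y - 1 < 0 by rewrite e0 mulr0 mul0r; lra.
    exact: (@cvgr_lt R _ (nbhs y) _ _ _ (cchi' y Uy) 0 lt0).
  move=> H; have E1 : {near y, F0 =1 F1}.
    apply: filterS H => z /ltW /chi0 cz.
    by rewrite /F1 cz scale0r addr0.
  have Fy : F1 y = F0 y by rewrite (nbhs_singleton E1).
  rewrite /prop_for /continuous_at Fy.
  exact: cvg_trans (near_eq_cvg E1) (cF0 y Uy).
have F10 y : U y -> `|F1 y - F0 y| <= 20^-1.
  move=> Uy; rewrite /F1 addrAC subrr add0r.
  have [->|/eqP nz] := eqVneq (chi y) 0; first by rewrite scale0r normr0 ltW.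
  have Ey := interior_subset (e_int y (chi_pos y Uy nz)).
  have /andP[h0 h1] := chi01 y.
  rewrite normrZ (ger0_norm h0) distrC; have := F0f y Ey => h.
  by apply: le_trans (ltW h); rewrite ler_piMl.
have F1C y : U y -> a y <= e y -> F1 y <> 0.
  move=> Uy ae; rewrite /F1 chi1 // scale1r addrC subrK; apply: f0; apply: e_int.
  exact: lt_le_trans (a_gt0 y Uy) ae.
(* delta is positive, and at most |F1| where e >= a. *)
pose delta y : R := Num.min 20^-1 (Num.max `|F1 y| (a y - e y)).
have d_gt0 y : U y -> 0 < delta y.
  move=> Uy; rewrite /delta lt_min c20 lt_max /= subr_gt0 orbC.
  have [//|ae] := ltP (e y) (a y); rewrite normr_gt0; apply/eqP; exact: F1C.
have cdelta y : U y -> {for y, continuous delta}.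
  move=> Uy; apply: cont_min; first exact: cont_cst.
  apply: cont_max; first by apply: cont_norm; exact: cF1.
  by apply: contBr; [exact: ca | exact: ce].
(* Approximating F1 / delta with a constant error and multiplying by delta
   perturbs F1 by less than delta. *)
have cH : {within U, continuous (fun y => (delta y)^-1 *: F1 y)}.
  apply: within_continuousT => y Uy; apply: contZ; last exact: cF1.
  by apply: contV; [rewrite gt_eqF // d_gt0 | exact: cdelta].
have c2 : 0 < 2^-1 :> R by rewrite invr_gt0.
have [U' [G [_ UU' lG GF1]]] := lipschitz_approx c2 cH.
have [p [r [pY r0 pr dense]]] := dense_sphere_family Yn.
have [c [cn cG]] := @lipschitz_avoid_spheres _ _ U' G p r 2^-1 lG c2.
pose F3 y := delta y *: (G y - c).
have cF3 y : U y -> {for y, continuous F3}.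
  move=> Uy; apply: contZ; first exact: cdelta.
  apply: contB; last exact: cont_cst.
  by apply: locally_lipschitz_continuous lG _; exact: UU'.
have F31 y : U y -> `|F3 y - F1 y| < delta y.
  move=> Uy; have dy := d_gt0 y Uy.
  have -> : F3 y - F1 y = delta y *: (G y - (delta y)^-1 *: F1 y - c).
    by rewrite /F3 !scalerBr scalerA divff ?gt_eqF // scale1r addrAC.
  rewrite normrZ gtr0_norm // -[ltRHS]mulr1 ltr_pM2l //.
  by apply: (le_lt_trans (ler_normB _ _)); have := GF1 y Uy; lra.
have d20 y : delta y <= 20^-1 by rewrite /delta ge_min lexx.
have F30 y : U y -> `|F3 y - F0 y| < 1 / 10.
  move=> Uy; rewrite -[F3 y - F0 y](subrKA (F1 y)).
  apply: (le_lt_trans (ler_normD _ _)).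
  by have := F31 y Uy; have := F10 y Uy; have := d20 y; lra.
have F3z y : U y -> F3 y = 0 -> a y = b y / 16 /\ e y < a y.
  move=> Uy Fz; split.
    have := F30 y Uy; rewrite Fz sub0r normrN => h; rewrite /a max_l //.
    by have := cdist_ge0 (~` N) y; rewrite -/(b y); lra.
  rewrite ltNge; apply/negP => ae; have := F31 y Uy.
  rewrite Fz sub0r normrN ltNge /delta ge_min ge_max lexx /= => /negP; apply.
  by apply/orP; right; apply: le_trans (normr_ge0 _); lra.
pose adm k := 4 * r k < b (p k).
have adm_N k : adm k -> forall y, `|y - p k| <= r k -> N y.
  move=> ak y yp; apply: contrapT; apply: (@cdist_notin _ _ (~` N) (p k) y).
  by rewrite distrC -/(b (p k)); have := r0 k; move: ak; rewrite /adm; lra.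
have [|||g Hg] := @remove_zeros R n.+1 n.+1 U N F3 p r adm oU cF3 r0 pr adm_N NU.
- by move=> k /lt_le_trans; apply; apply: cdist_subset; exact: subsetC.
- move=> k y ak Uy yk; have := cG k y (UU' _ Uy) yk => Gc /eqP.
  by rewrite scaler_eq0 gt_eqF ?d_gt0 //= subr_eq0 => /eqP.
- move=> y Uy Fz; have [ab ea] := F3z y Uy Fz; have a0 := a_gt0 y Uy.
  have b1 : b y <= 1 by exact: cdist_le1.
  have [|p0 Yp0 yp0] := @cdist_lt _ _ Y y (a y) _ ea; first by lra.
  have gap : 0 < a y - `|y - p0| by lra.
  have [||k [k1 /andP[k2 k3]]] :=
    dense p0 (a y - `|y - p0|) (a y) (2 * a y) Yp0 gap.
    exact: ltW.
    lra.
  have yk : `|y - p k| < a y.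
    by rewrite -[y - p k](subrKA p0); apply: (le_lt_trans (ler_normD _ _)); lra.
  exists k; split; last by lra.
  have := cdist_lipschitz (~` N) y (p k); rewrite -/(b y) -/(b (p k)) /adm.
  by rewrite ler_norml => /andP[_]; lra.
have Ep x : E x -> ~ range p x by move=> Ex [k _ pk]; apply: (pY k); rewrite pk.
exists g; split.
- by apply: within_continuousT => x Ex; have [] := Hg x (EU _ Ex) (Ep _ Ex).
- by move=> x Ex; have [] := Hg x (EU _ Ex) (Ep _ Ex).
move=> x Ex; have [_ _] := Hg x (EU _ Ex) (Ep _ Ex).
have hf := F0f x Ex.
have i20 : 20^-1 = 1 / 20 :> R by rewrite div1r.
case=> [->|[[_ Nx] [y' [Uy' Ny'] ->]]].
  rewrite -[F3 x - f x](subrKA (F0 x)); apply: (le_lt_trans (ler_normD _ _)).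
  by have := F30 x (EU _ Ex); lra.
have h3 : `|F3 y'| < 3 / 10.
  rewrite -[F3 y'](subrK (F0 y')); apply: (le_lt_trans (ler_normD _ _)).
  by have := F30 y' Uy'; lra.
have h4 : `|f x| < 1 / 4.
  rewrite -[f x](subrK (F0 x)); apply: (le_lt_trans (ler_normD _ _)).
  by rewrite distrC; lra.
by apply: (le_lt_trans (ler_normB _ _)); lra.
Qed.

(** * Cozero charts *)

Lemma continuous_preimage_nbhs (T U : topologicalType) (f : T -> U) y A :
  {for y, continuous f} -> nbhs (f y) A -> nbhs y (f @^-1` A).
Proof. by move=> cf; exact: cf. Qed.

(** An open chart domain together with a function lam that is positive exactly
    on it; lam lets a modification made in the chart fade out at its
    boundary. *)
Definition cozero_chart (R : realType) n (M : topologicalType) (O : set M) :=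
  exists (phi : M -> 'rV[R]_n) (psi : 'rV[R]_n -> M) (lam : M -> R),
  [/\ forall x, O x ->
        [/\ {for x, continuous phi}, psi (phi x) = x &
            {for phi x, continuous psi}],
      continuous lam, forall x, 0 <= lam x <= 1 & forall x, O x <-> 0 < lam x].

Lemma valL_val (T : Type) (V : Type) (A : set T) (v : V) (f : A -> V) (u : A) :
  valL_ v f (set_val u) = f u.
Proof. exact: (congr1 (fun g => g u) (@valLK _ _ v A f)). Qed.

(** B is an open ball in a chart whose closed ball is still in the chart.  The
    image K of the closed ball is compact, hence closed in M.  For O in B take
    for lam the distance in the chart to the complement of O; a boundary point
    of O is in K, where the chart is continuous, and off K lam is zero. *)
Lemma locally_euclidean_cozero (R : realType) n (M : topologicalType) :
  hausdorff_space M -> locally_euclidean R n M ->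
  forall x : M, exists B : set M, [/\ open B, B x &
    forall O, open O -> O `<=` B -> cozero_chart R n O].
Proof.
move=> hM eM x; have [U [V [Ux oV [h [k [ch ck hk kh]]]]]] := eM x.
pose phi : M -> 'rV[R]_n := valL_ 0 (set_val \o h).
pose psi : 'rV[R]_n -> M := valL_ x (set_val \o k).
have cval (T : topologicalType) (A : set T) : continuous (set_val : A -> T).
  exact: initial_continuous.
have cphi : {within U, continuous phi}.
  by apply/subspace_valL_continuousP' => z; apply: continuous_comp;
    [exact: ch | exact: cval].
have cpsi : {within V, continuous psi}.
  by apply/subspace_valL_continuousP' => z; apply: continuous_comp;
    [exact: ck | exact: cval].
have cphi' z : U° z -> {for z, continuous phi}.
  exact: within_continuous_interior.
have cpsi' y : V y -> {for y, continuous psi}.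
  by move=> Vy; apply: (within_continuous_interior cpsi); rewrite (interior_id V).1.
have phiV z : U z -> V (phi z) /\ psi (phi z) = z.
  move=> Uz; pose u : U := SigSub (mem_set Uz).
  rewrite (_ : z = set_val u) // /phi valL_val /=; split; first exact: set_valP.
  by rewrite /psi valL_val /= hk.
have psiU y : V y -> U (psi y) /\ phi (psi y) = y.
  move=> Vy; pose v : V := SigSub (mem_set Vy).
  rewrite (_ : y = set_val v) // /psi valL_val /=; split; first exact: set_valP.
  by rewrite /phi valL_val /= kh.
have Ux' : U x := nbhs_singleton Ux.
pose y0 := phi x; have [Vy0 psiy0] := phiV x Ux'.
have oUi : open U° by exact: open_interior.
have : \forall y \near y0, V y /\ U° (psi y).
  apply: filterI; first exact: open_nbhs_nbhs.
  by apply: (cpsi' y0 Vy0); rewrite psiy0; apply: open_nbhs_nbhs.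
move=> /nbhs_ballP[d0 /= d00 Hd0].
pose d := d0 / 2; have d_gt0 : 0 < d by rewrite divr_gt0.
pose D := [set y : 'rV[R]_n | `|y - y0| <= d].
have DV y : D y -> V y /\ U° (psi y).
  move=> Dy; apply: Hd0; rewrite -ball_normE /= distrC.
  by apply: (le_lt_trans Dy); rewrite /d; lra.
pose B := U° `&` [set z | `|phi z - y0| < d].
pose K := psi @` D.
have cK : closed K.
  apply: compact_closed => //.
  apply: continuous_compact; last exact: compact_norm_ball.
  by apply: within_continuousT => y Dy; apply: cpsi'; have [] := DV y Dy.
have BK : B `<=` K.
  move=> z [Uz zd]; exists (phi z); first exact: ltW.
  by have [] := phiV z (interior_subset Uz).
have KU : K `<=` U° by move=> _ [y Dy <-]; have [] := DV y Dy.
exists B; split.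
- rewrite openE => z [Uz zd]; apply: filterI; first exact: open_nbhs_nbhs.
  have cz : {for z, continuous (fun w => `|phi w - y0|)}.
    by apply: cont_norm; apply: contB; [exact: cphi' | exact: cont_cst].
  exact: (@cvgr_lt R _ (nbhs z) _ _ _ cz d zd).
- by split => //=; rewrite -/y0 subrr normr0.
move=> O oO OB.
pose W := [set y : 'rV[R]_n | `|y - y0| < d /\ O (psi y)].
have oW : open W.
  rewrite openE => y [yd Oy]; apply: filterI.
    exact: (@cvgr_lt R _ (nbhs y) _ _ _ (@dist_continuous R _ y0 y) d yd).
  apply: (cpsi' y); last exact: open_nbhs_nbhs.
  by have [] := DV y (ltW yd).
have WP z : U° z -> W (phi z) <-> O z.
  move=> Uz; have [_ e] := phiV z (interior_subset Uz).
  rewrite /W /= e; split=> [[]//|Oz]; split => //.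
  by have [] := OB z Oz.
pose lam z : R := if `[< U° z >] then cdist (~` W) (phi z) else 0.
have lamP z : O z <-> 0 < lam z.
  rewrite /lam; case: asboolP => [Uz|nUz].
    rewrite -WP //; split=> [Wz|]; first by apply: cdist_gt0; [rewrite setCK|exact].
    move=> c0; apply: contrapT => nW; move: c0; rewrite ltNge => /negP; apply.
    by apply: (le_trans (cdist_le _ nW)); rewrite subrr normr0.
  by rewrite ltxx; split => // Oz; have [] := OB z Oz.
have lam01 z : 0 <= lam z <= 1.
  by rewrite /lam; case: asboolP => _; rewrite ?cdist_ge0 ?cdist_le1 // lexx ler01.
exists phi, psi, lam; split => //.
- move=> z Oz; have [Uz zd] := OB z Oz.
  have [Vz e] := phiV z (interior_subset Uz); split => //; first exact: cphi'.
  exact: cpsi'.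
- move=> z; have [Uz|nUz] := pselect (U° z).
    have E : {near z, (fun w => cdist (~` W) (phi w)) =1 lam}.
      have := open_nbhs_nbhs (conj oUi Uz); apply: filterS => w Uw.
      by rewrite /lam asboolT.
    have E0 : lam z = cdist (~` W) (phi z) by rewrite (nbhs_singleton E).
    rewrite /continuous_at E0; apply: cvg_trans (near_eq_cvg E) _.
    have := @continuous_comp _ _ _ phi (cdist (~` W)) z (cphi' z Uz).
    by apply; exact: cdist_continuous.
  have nKz : ~ K z by move=> /KU.
  have E : {near z, (fun=> 0) =1 lam}.
    have oK : open (~` K) by rewrite openC.
    have := open_nbhs_nbhs (conj oK nKz); apply: filterS => w nKw /=.
    have /andP[l0 _] := lam01 w; apply/eqP; rewrite eq_le l0 leNgt; apply/negP.
    by move=> /lamP/OB/BK.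
  rewrite /continuous_at -(nbhs_singleton E).
  by apply: cvg_trans (near_eq_cvg E) _; exact: cvg_cst.
Qed.

(** Dividing f by mu = lam eps turns the tolerance mu into the constant 1; since
    mu tends to 0 at the boundary of O, the modified map and f agree there in
    the limit. *)
Lemma chart_zero_free (R : realType) n (M : topologicalType) (E O : set M)
    (f : M -> 'rV[R]_n.+1) (eps : M -> R) :
  cozero_chart R n.+1 O ->
  {within E, continuous f} -> {within E, continuous eps} ->
  (forall x, E x -> 0 < eps x) -> (forall x, E° x -> f x <> 0) ->
  exists g : M -> 'rV[R]_n.+1,
  [/\ {within E, continuous g}, forall x, ~ O x -> g x = f x,
      forall x, E x -> O x -> g x <> 0 &
      forall x, E x -> `|g x - f x| < eps x].
Proof.
move=> [phi [psi [lam [chart clam lam01 lamP]]]] cf ceps eps0 f0.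
have oO : open O.
  rewrite (_ : O = lam @^-1` [set t | 0 < t]).
    by apply: open_comp => //; exact: open_gt.
  by apply/seteqP; split => x /lamP.
pose mu x := lam x * eps x.
have mu0 x : E x -> O x -> 0 < mu x.
  by move=> Ex /lamP lx; rewrite mulr_gt0 // eps0.
have cmu : {within E, continuous mu}.
  apply/within_contP => x Ex.
  apply: cvgM; last exact: ((within_contP _ _).1 ceps).
  apply: cvg_trans (clam x); apply: cvg_app; exact: cvg_within.
pose E' := phi @` (E `&` O).
pose f' y := (mu (psi y))^-1 *: f (psi y).
have cf' : {within E', continuous f'}.
  apply/within_contP => _ [x [Ex Ox] <-].
  have [_ e cpsi] := chart x Ox.
  have wpsi : psi @ within E' (nbhs (phi x)) --> within E (nbhs x).
    move=> A wA; have cA : nbhs (phi x) [set y | E (psi y) -> A (psi y)].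
      apply: (continuous_preimage_nbhs cpsi (A := [set z | E z -> A z])).
      by rewrite e.
    change (nbhs (phi x) [set y | E' y -> A (psi y)]).
    apply: filterS cA => y HA [z [Ez Oz] zy].
    by apply: HA; rewrite -zy; have [_ -> _] := chart z Oz.
  have -> : f' (phi x) = (mu x)^-1 *: f x by rewrite /f' e.
  have cm : mu \o psi @ within E' (nbhs (phi x)) --> mu x.
    exact: cvg_comp wpsi ((within_contP _ _).1 cmu x Ex).
  have cff : f \o psi @ within E' (nbhs (phi x)) --> f x.
    exact: cvg_comp wpsi ((within_contP _ _).1 cf x Ex).
  apply: cvgZ => //; apply: cvgV => //.
  by rewrite gt_eqF // mu0.
have f'0 y : E'° y -> f' y <> 0.
  move=> E'y; have [x [Ex Ox] xy] := interior_subset E'y; subst y.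
  have [cphi e _] := chart x Ox.
  have Eix : E° x.
    have : \forall z \near x, E' (phi z) /\ O z.
      by apply: filterI; [exact: cphi | exact: open_nbhs_nbhs].
    apply: filterS => z [[w [Ew Ow] wz] Oz].
    have [_ <- _] := chart z Oz; rewrite -wz.
    by have [_ -> _] := chart w Ow.
  rewrite /f' e => /eqP; rewrite scaler_eq0 invr_eq0 gt_eqF ?mu0 //= => /eqP.
  exact: f0.
have [g' [cg' g'0 g'f']] := euclidean_zero_free cf' f'0.
pose g x := if `[< O x >] then mu x *: g' (phi x) else f x.
have gO x : O x -> g x = mu x *: g' (phi x) by move=> Ox; rewrite /g asboolT.
have gnO x : ~ O x -> g x = f x by move=> Ox; rewrite /g asboolF.
have gmu x : E x -> `|g x - f x| <= mu x.
  move=> Ex; have [Ox|nO] := pselect (O x); last first.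
    rewrite gnO // subrr normr0 mulr_ge0 //; last by rewrite ltW // eps0.
    by have /andP[] := lam01 x.
  have m0 := mu0 x Ex Ox; have [_ e _] := chart x Ox.
  have -> : g x - f x = mu x *: (g' (phi x) - f' (phi x)).
    by rewrite gO // scalerBr /f' e scalerA divff ?gt_eqF // scale1r.
  rewrite normrZ gtr0_norm // ler_piMr ?ltW //.
  by apply: g'f'; exists x.
exists g; split => //.
- apply/within_contP => x Ex; have [Ox|nO] := pselect (O x).
    have [cphi e _] := chart x Ox.
    have wphi : phi @ within (E `&` O) (nbhs x) --> within E' (nbhs (phi x)).
      move=> A wA; have := cphi _ wA; rewrite /= /nbhs /= /within /=.
      by apply: filterS => z Hz EOz; apply: Hz; exists z.
    have wEO : within (E `&` O) (nbhs x) = within E (nbhs x).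
      apply/seteqP; split => A; rewrite /within /=.
        move=> HA; have := open_nbhs_nbhs (conj oO Ox).
        by apply: filterS2 HA => z Hz Oz Ez; apply: Hz.
      by apply: filterS => z Hz [Ez _]; exact: Hz.
    rewrite gO //.
    have cc : (fun z => mu z *: g' (phi z)) @ within E (nbhs x) --> mu x *: g' (phi x).
      apply: cvgZ; first exact: ((within_contP _ _).1 cmu).
      rewrite -wEO; apply: cvg_comp wphi _.
      by apply: ((within_contP _ _).1 cg'); exists x.
    apply: cvg_trans cc; apply: near_eq_cvg.
    apply: cvg_within; have := open_nbhs_nbhs (conj oO Ox).
    by apply: filterS => z Oz; rewrite gO.
  have lx : lam x = 0.
    have /andP[l0 _] := lam01 x; apply/eqP; rewrite eq_le l0 andbT leNgt.
    by apply/negP => /lamP.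
  have cmx : mu @ within E (nbhs x) --> 0.
    by have := (within_contP _ _).1 cmu x Ex; rewrite /mu lx mul0r.
  have cfx := (within_contP _ _).1 cf x Ex.
  rewrite gnO // -[f x]addr0.
  rewrite (_ : g = fun z => f z + (g z - f z)); last first.
    by apply/funext => z; rewrite addrC subrK.
  apply: cvgD => //; apply/cvgr0Pnorm_lt => e e0.
  have mue := (cvgr0Pnorm_lt mu).1 cmx e e0.
  near=> z; have Ez : E z by near: z; exact: withinT.
  have : `|mu z| < e by near: z; exact: mue.
  by apply: le_lt_trans; apply: (le_trans (gmu z Ez)); exact: ler_norm.
- move=> x Ex Ox; rewrite gO // => /eqP; rewrite scaler_eq0 gt_eqF ?mu0 //= => /eqP.
  by apply: g'0; exists x.
- move=> x Ex; have [Ox|nO] := pselect (O x).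
    2: by rewrite gnO // subrr normr0 eps0.
  have m0 := mu0 x Ex Ox; have [_ e _] := chart x Ox.
  have -> : g x - f x = mu x *: (g' (phi x) - f' (phi x)).
    by rewrite gO // scalerBr /f' e scalerA divff ?gt_eqF // scale1r.
  rewrite normrZ gtr0_norm //.
  apply: (@lt_le_trans _ _ (mu x)).
    by rewrite gtr_pMr //; apply: g'f'; exists x.
  by have /andP[_ l1] := lam01 x; rewrite /mu ler_piMl // ltW // eps0.
Unshelve. all: by end_near. Qed.

(** * Patching over a manifold *)

(** Induction on K: of two members of the chain, the larger one absorbs the next
    element. *)
Lemma chain_finite (T I : Type) (A : set T) (le : T -> T -> Prop)
    (J : T -> set I) (K : set I) :
  total_on A le -> (forall a b, le a b -> J a `<=` J b) ->
  A !=set0 -> finite_set K -> (forall i, K i -> exists2 a, A a & J a i) ->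
  exists2 a, A a & K `<=` J a.
Proof.
elim/Pchoice : I => I in J K *; move=> tA mJ [a0 Aa0] /finite_seqP[s ->].
elim: s => [|i s IH] H; first by exists a0.
have [a Aa Ha] : exists2 a, A a & [set` s] `<=` J a.
  by apply: IH => j js; apply: H; rewrite /= in_cons js orbT.
have [b Ab Hb] := H i (mem_head _ _).
have [ab|ba] := tA a b Aa Ab; [exists b|exists a] => // j /=;
  rewrite in_cons => /orP[/eqP ->//|js].
- exact: mJ ab _ (Ha _ js).
- exact: mJ ba _ Hb.
- exact: Ha.
Qed.

(** Zorn's lemma on pairs (J, h), where J is a set of members of the cover and h
    is a solution on E meet the union of J.  A larger pair may change h only on
    its new members.  Along a chain the maps are locally eventually constant,
    because only finitely many members of the cover meet a small
    neighbourhood; so chains have upper bounds.  At a maximal pair J is the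
    whole cover, since the tolerance left over, eps - |h - f|, is positive and
    [chart_zero_free] applies to any further member. *)
Lemma manifold_zero_free (R : realType) n (M : topologicalType) (E : set M)
    (f : M -> 'rV[R]_n.+1) (eps : M -> R) :
  manifold R n.+1 M ->
  {within E, continuous f} -> {within E, continuous eps} ->
  (forall x, E x -> 0 < eps x) -> (forall x, E° x -> f x <> 0) ->
  exists g : M -> 'rV[R]_n.+1,
  [/\ {within E, continuous g}, forall x, E x -> g x <> 0 &
      forall x, E x -> `|g x - f x| < eps x].
Proof.
move=> [pM hM eM] cf ceps eps0 f0.
pose F := [set B : set M | open B /\
  forall O, open O -> O `<=` B -> cozero_chart R n.+1 O].
have oF : open_cover F.
  split; first by move=> B [].
  apply/seteqP; split => // x _.
  by have [B [oB Bx HB]] := locally_euclidean_cozero hM eM x; exists B.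
have [G [[oG Gcover] Gref Gfin]] := pM F oF.
have Gchart O : G O -> cozero_chart R n.+1 O.
  by move=> GO; have [B [_ HB] OB] := Gref O GO; apply: HB => //; exact: oG.
pose valid (J : set (set M)) (g : M -> 'rV[R]_n.+1) :=
  [/\ J `<=` G, {within E, continuous g},
      forall x, E x -> `|g x - f x| < eps x,
      forall x, E° x -> g x <> 0 &
      forall O x, J O -> O x -> E x -> g x <> 0].
pose T := {Jg : set (set M) * (M -> 'rV[R]_n.+1) | valid Jg.1 Jg.2}.
pose J (t : T) := (projT1 t).1; pose h (t : T) := (projT1 t).2.
have tP (t : T) : valid (J t) (h t) := projT2 t.
pose le (s t : T) := J s `<=` J t /\
  forall x, (forall O, J t O -> O x -> J s O) -> h t x = h s x.
have v0 : valid set0 f by split => // x Ex; rewrite subrr normr0 eps0.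
pose t0 : T := exist (fun Jg => valid Jg.1 Jg.2) (set0, f) v0.
have [] := @ZL_preorder T t0 (fun s t => `[< le s t >]).
- by move=> t; apply/asboolP; split.
- move=> r s t /asboolP[rs Hrs] /asboolP[st Hst]; apply/asboolP; split.
    exact: subset_trans rs st.
  move=> x Hx; rewrite Hst ?Hrs // => O JO Ox.
    by apply: Hx => //; exact: st.
  by apply: rs; exact: Hx.
- move=> A tA; have [A0|/set0P/negP/negPn/eqP A0] := pselect (A !=set0); last first.
    by exists t0 => s; rewrite A0.
  have tA' : total_on A le.
    by move=> s t As At; have [/asboolP|/asboolP] := tA s t As At; [left|right].
  (* Members of the chain that already contain every member of JJ around x agree
   at x. *)
pose JJ := \bigcup_(a in A) J a.
  pose stable x a := A a /\ forall O, JJ O -> O x -> J a O.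
  have stable_eq x a b : stable x a -> stable x b -> h a x = h b x.
    move=> [Aa Ha] [Ab Hb]; have [[ab H]|[ba H]] := tA' a b Aa Ab.
      by rewrite H // => O JO Ox; apply: Ha => //; exists b.
    by rewrite H // => O JO Ox; apply: Hb => //; exists a.
  have stable_near (x : M) : exists a, \forall w \near x, stable w a.
    have [N Nx Nfin] := Gfin x.
    have fK : finite_set (JJ `&` [set U | G U /\ U `&` N !=set0]).
      exact: finite_setIr.
    have [||a Aa Ha] := @chain_finite _ _ A le J _ tA' _ A0 fK _.
    + by move=> a b [].
    + by move=> O [[a Aa JO] _]; exists a.
    exists a; apply: filterS Nx => w Nw; split => // O JO Ow.
    apply: Ha; split => //.
    split; last by exists w.
    by have [b Ab JbO] := JO; have [+ _ _ _ _] := tP b; apply.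
  pose c x := projT1 (cid (stable_near x)).
  pose g x := h (c x) x.
  have cx x : \forall w \near x, stable w (c x) by rewrite /c; case: cid.
  have gE x a : stable x a -> g x = h a x.
    by move=> sa; apply: stable_eq => //; exact: nbhs_singleton (cx x).
  have vg : valid JJ g.
    split.
    + by move=> O [a Aa JO]; have [+ _ _ _ _] := tP a; apply.
    + apply/within_contP => x Ex; have [_ /within_contP ch _ _ _] := tP (c x).
      have := ch x Ex; rewrite -/(g x); apply: cvg_trans; apply: near_eq_cvg.
      by apply: cvg_within; apply: filterS (cx x) => w /gE.
    + by move=> x Ex; have [_ _ + _ _] := tP (c x); apply.
    + by move=> x Ex; have [_ _ _ + _] := tP (c x); apply.
    + move=> O x JO Ox Ex; have [_ _ _ _ hz] := tP (c x); apply: (hz O) => //.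
      by have [_] := nbhs_singleton (cx x); apply.
  exists (exist (fun Jg => valid Jg.1 Jg.2) (JJ, g) vg) => s As; apply/asboolP.
  split; first by move=> O JO; exists s.
  by move=> x Hx; apply: gE; split.
move=> t tmax; have [JG ch hf h0 hJ] := tP t.
have GJ O : G O -> J t O.
  move=> GO; apply: contrapT => nJO; pose eps' x := eps x - `|h t x - f x|.
  have ceps' : {within E, continuous eps'}.
    apply/within_contP => x Ex; apply: cvgB; first by move/within_contP : ceps; apply.
    apply: cvg_norm; apply: cvgB; first by move/within_contP : ch; apply.
    by move/within_contP : cf; apply.
  have eps'0 x : E x -> 0 < eps' x by move=> Ex; rewrite subr_gt0; exact: hf.
  have [g [cg gnO gO geps]] := chart_zero_free (Gchart O GO) ch ceps' eps'0 h0.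
  have gh x : E x -> h t x <> 0 -> g x <> 0.
    by move=> Ex; have [Ox _|nO] := pselect (O x); [exact: gO | rewrite gnO].
  have vg : valid (J t `|` [set O]) g.
    split => //.
    + by move=> O' [/JG//|->].
    + move=> x Ex; rewrite -[g x - f x](subrKA (h t x)).
      apply: (le_lt_trans (ler_normD _ _)).
      by have := geps x Ex; rewrite /eps'; lra.
    + by move=> x Ex; apply: gh; [exact: interior_subset | exact: h0].
    + move=> O' x [JO'|->] O'x Ex; last exact: gO.
      by apply: gh => //; exact: hJ JO' O'x Ex.
  pose s : T := exist (fun Jg => valid Jg.1 Jg.2) (J t `|` [set O], g) vg.
  have lets : le t s.
    split; first by move=> ? ?; left.
    by move=> x Hx; apply: gnO => Ox; apply: nJO; apply: Hx => //; right.
  have /asboolP[sub _] := tmax s (asboolT lets).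
  by apply: nJO; apply: sub; right.
exists (h t); split => // x Ex.
have [W GW Wx] : (\bigcup_(W in G) W) x by rewrite Gcover.
exact: hJ (GJ W GW) Wx Ex.
Qed.

(** * The fine topology *)

(** Comparison with the sup norm, which the other lemmas use. *)
Lemma enorm_le (R : realType) n (v : 'rV[R]_n) : enorm v <= n%:R * `|v|.
Proof.
have nv0 : 0 <= n%:R * `|v| by rewrite mulr_ge0.
rewrite -[leRHS]ger0_norm // -sqrtr_sqr ler_wsqrtr // exprMn.
apply: (@le_trans _ _ (n%:R * `|v| ^+ 2)); last first.
  rewrite ler_wpM2r ?exprn_ge0 // -natrX ler_nat.
  by case: n {v nv0} => // n; rewrite leq_pmulr.
have -> : n%:R * `|v| ^+ 2 = \sum_(i < n) `|v| ^+ 2.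
  by rewrite sumr_const card_ord mulr_natl.
apply: ler_sum => i _; rewrite -real_normK ?num_real //.
by rewrite lerXn2r ?nnegrE // rV_coord_le.
Qed.

Theorem theorem1p2 (R : realType) (n : nat) (M : topologicalType) (E : set M)
    (f : fine_space E R n) :
  (0 < n)%N ->
  manifold R n M ->
  zero_free (set_val @^-1` E°) f ->
  closure [set g : fine_space E R n | zero_free setT g] f /\
  forall eps : E -> R, continuous eps -> (forall x, 0 < eps x) ->
    exists g : E -> 'rV[R]_n,
      [/\ continuous g, forall x, g x <> 0 &
          forall x, enorm (f x - g x) < eps x].
Proof.
case: n f => // n f _ mM f0.
have approx : forall eps : E -> R, continuous eps -> (forall x, 0 < eps x) ->
    exists g : E -> 'rV[R]_n.+1,
      [/\ continuous g, forall x, g x <> 0 &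
          forall x, enorm (f x - g x) < eps x].
  move=> eps ceps eps0.
  pose f1 : M -> 'rV[R]_n.+1 := valL_ 0 f.
  pose eps1 : M -> R := valL_ 0 (fun x => eps x / n.+1%:R).
  have valE x : E x -> exists u : E, x = set_val u.
    by move=> Ex; exists (SigSub (mem_set Ex)).
  have cf1 : {within E, continuous f1}.
    by apply/subspace_valL_continuousP'; exact: cts_fun.
  have ceps1 : {within E, continuous eps1}.
    apply/subspace_valL_continuousP' => u.
    exact: (contM (ceps u) (@cont_cst _ u R n.+1%:R^-1)).
  have [x /valE[u ->]|x Ex|g [cg g0 gf]] := @manifold_zero_free R n M E f1 eps1 mM cf1 ceps1.
  - by rewrite /eps1 valL_val divr_gt0.
  - have [u xu] := valE x (interior_subset Ex); rewrite xu /f1 valL_val.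
    by apply: f0; rewrite /= -xu.
  exists (sigL E g); split.
  - exact/subspace_sigL_continuousP.
  - by move=> u; apply: g0; exact: set_valP.
  - move=> u; apply: (le_lt_trans (enorm_le _)).
    have := gf (set_val u) (set_valP u); rewrite /eps1 /f1 !valL_val distrC.
    by rewrite ltr_pdivlMr // mulrC.
split => // B; rewrite nbhsE => -[_ [[D' D'base <-] [C D'C Cf]] CB].
have [f1 [eps [ceps eps0 CE]]] := D'base C D'C.
pose eps' x := eps x - enorm (f1 x - f x).
have ceps' : continuous eps'.
  move=> x; apply: (contBr (ceps x)).
  apply: (@continuous_comp _ _ _ (fun x => f1 x - f x) (@enorm R n.+1)).
    exact: (contB (@cts_fun _ _ f1 x) (@cts_fun _ _ f x)).
  exact: enorm_continuous.
have eps'0 x : 0 < eps' x by rewrite subr_gt0; move: Cf; rewrite CE; apply.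
have [g [cg g0 gf]] := approx eps' ceps' eps'0.
pose g1 : fine_space E R n.+1 :=
  HB.pack g (@isContinuous.Build E 'rV[R]_n.+1 g cg).
exists g1; split; first by move=> x _; exact: g0.
have Cg1 : fine_ball f1 eps g1.
  move=> x; rewrite -[f1 x - g1 x](subrKA (f x)).
  apply: (le_lt_trans (enormD _ _)).
  by have := gf x; rewrite /eps'; lra.
by apply: CB; exists C => //; rewrite CE.
Qed.
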